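(* Let $\overline{M}$ be a compact, connected, smooth Riemannian manifold with nonempty boundary $\partial M$ and interior $M$. There exists a constant $C=C(\overline{M})>0$ such that for all $u\in H^1_0(M)$ $$\|u\|^2_{L^2(M)}\leq C\,\|du\|^2_{L^2(M)}.$$
   Context: $L^2(M)$ and $\|du\|_{L^2(M)}$ are taken with respect to the Riemannian volume measure and the induced pointwise norm on $T^*M$. For a nonnegative integer $k$, $H^k(M)$ is the space of all $u\in L^2(M)$ such that $Pu\in L^2(M)$ for every differential operator $P$ of order at most $k$ with coefficients in $C^\infty(\overline{M})$, with its natural Hilbert space topology. $H^1_0(M)$ is the closure of $C_c^\infty(M)$ (smooth functions compactly supported in the interior $M$) in $H^1(M)$. *)

(* Defs.v *)
From HB Require Import structures.
From mathcomp Require Import all_boot all_order all_algebra.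
From mathcomp Require Import all_classical all_reals all_analysis.

Set Implicit Arguments.
Unset Strict Implicit.
Unset Printing Implicit Defensive.

Import Order.TTheory GRing.Theory Num.Theory.
Import numFieldNormedType.Exports.

Local Open Scope classical_set_scope.
Local Open Scope ring_scope.

(** * Lebesgue measure on R^n, built on n-tuples as an iterated product *)

Definition tuple_cons (T : Type) n (p : T * n.-tuple T) : n.+1.-tuple T :=
  [tuple of p.1 :: p.2].

Definition tuple_uncons (T : Type) n (t : n.+1.-tuple T) : T * n.-tuple T :=
  (thead t, [tuple of behead t]).

Lemma tuple_consK (T : Type) n : cancel (@tuple_cons T n) (@tuple_uncons T n).
Proof. by move=> [x t]; congr pair; apply: val_inj. Qed.

Section lebesgue_cons.
Context {R : realType} (n : nat).
Local Notation T := (measurableTypeR R).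
Variable m : {sigma_finite_measure set (n.-tuple T) -> \bar R}.

Lemma measurable_tuple_cons :
  measurable_fun [set: T * n.-tuple T] (@tuple_cons T n).
Proof. exact: (measurable_cons measurable_fst measurable_snd). Qed.

Lemma measurable_tuple_uncons :
  measurable_fun [set: n.+1.-tuple T] (@tuple_uncons T n).
Proof.
apply/measurable_fun_pairP; split; last exact: measurable_behead.
exact: measurable_tnth.
Qed.

Definition lebesgue_cons : set (n.+1.-tuple T) -> \bar R :=
  pushforward (product_measure1 (@lebesgue_measure R) m) (@tuple_cons T n).

Let mu := measure_function_pushforward__canonical__measure_function_Measure
  (product_measure1 (@lebesgue_measure R) m) measurable_tuple_cons.

Let lebesgue_cons0 : lebesgue_cons set0 = 0%E.
Proof. exact: (measure0 mu). Qed.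

Let lebesgue_cons_ge0 A : (0 <= lebesgue_cons A)%E.
Proof. exact: (measure_ge0 mu). Qed.

Let lebesgue_cons_sigma_additive : semi_sigma_additive lebesgue_cons.
Proof. exact: (@measure_semi_sigma_additive _ _ _ mu). Qed.

HB.instance Definition _ := isMeasure.Build _ _ _ lebesgue_cons
  lebesgue_cons0 lebesgue_cons_ge0 lebesgue_cons_sigma_additive.

Let lebesgue_cons_sigma_finite : sigma_finite setT lebesgue_cons.
Proof.
have /sigma_finiteP[F [TF ndF Foo]] := sigma_finiteT (@lebesgue_measure R).
have /sigma_finiteP[G [TG ndG Goo]] := sigma_finiteT m.
exists (fun k => @tuple_uncons T n @^-1` (F k `*` G k)).
  rewrite -preimage_bigcup -[LHS](preimage_setT (@tuple_uncons T n)).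
  congr (_ @^-1` _); rewrite -setXTT TF TG predeqE => -[x y]; split.
    move=> [/= [i _ Fx] [k _ Gy]]; exists (maxn i k) => //; split.
    - by move: x Fx; exact/subsetPset/ndF/leq_maxl.
    - by move: y Gy; exact/subsetPset/ndG/leq_maxr.
  by move=> [i _ []/= ? ?]; split; exists i.
move=> k; have [mF Fk] := Foo k; have [mG Gk] := Goo k; split.
  rewrite -[X in measurable X]setTI; apply: measurable_tuple_uncons => //.
  exact: measurableX.
rewrite /lebesgue_cons /pushforward (_ : _ @^-1` _ = F k `*` G k).
  by rewrite product_measure1E// lte_mul_pinfty// ge0_fin_numE.
by apply/seteqP; split=> p; rewrite /preimage/mkset tuple_consK.
Qed.

HB.instance Definition _ := Measure_isSigmaFinite.Build _ _ _ lebesgue_cons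
  lebesgue_cons_sigma_finite.

End lebesgue_cons.

Fixpoint lebesgue_tuple {R : realType} (n : nat) :
    {sigma_finite_measure set (n.-tuple (measurableTypeR R)) -> \bar R} :=
  if n is k.+1 then lebesgue_cons (lebesgue_tuple k)
  else \d_([tuple] : 0.-tuple (measurableTypeR R)).

Lemma lebesgue_tuple_box (R : realType) n (a b : nat -> R) :
  (forall i, a i <= b i) ->
  lebesgue_tuple n [set t : n.-tuple (measurableTypeR R) |
      forall i : 'I_n, `[a i, b i]%classic (tnth t i)] =
    (\prod_(i < n) (b i - a i))%:E.
Proof.
elim: n a b => [|n IH] a b ab.
  rewrite big_ord0 /=. rewrite diracE mem_set//. by case.
rewrite big_ord_recl /= /lebesgue_cons /pushforward.
rewrite (_ : _ @^-1` _ = `[a 0%N, b 0%N]%classic `*`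
  [set t : n.-tuple (measurableTypeR R) | forall i : 'I_n, `[a i.+1, b i.+1]%classic (tnth t i)]).
rewrite product_measure1E.
- transitivity ((if (a 0%N)%:E < (b 0%N)%:E then (b 0%N)%:E - (a 0%N)%:E else 0) * (\prod_(i < n) (b i.+1 - a i.+1))%:E)%E.
    congr mule; first exact: (@lebesgue_measure_itv R (Interval (BLeft (a 0%N)) (BRight (b 0%N)))).
    by apply: (IH (a \o succn) (b \o succn)) => i; exact: ab.
  rewrite lte_fin; case: ltP => [_|h]; first by rewrite -EFinD -EFinM.
  have -> : b 0%N = a 0%N by apply/eqP; rewrite eq_le h ab.
  by rewrite subrr mul0e mul0r.
- exact: measurable_itv.
- rewrite (_ : [set _ | _] = \bigcap_(i in [set: 'I_n]) ((fun t : n.-tuple (measurableTypeR R) => tnth t i) @^-1` `[a i.+1, b i.+1]%classic)).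
  + apply: fin_bigcap_measurable; first exact: finite_finset.
    move=> i _; rewrite -[X in measurable X]setTI; apply: measurable_tnth => //; exact: measurable_itv.
  + by apply/seteqP; split=> t h i; [move=> _; exact: h|exact: (h i I)].
- apply/seteqP; split=> -[x t] /=.
  + move=> h; split; first by have := h ord0; rewrite (tnth_nth x).
    move=> i; have := h (lift ord0 i). by rewrite !(tnth_nth x) /= /bump.
  + move=> [h0 h] i; case: (unliftP ord0 i) => [j ->|->].
    * by have := h j; rewrite !(tnth_nth x).
    * by rewrite (tnth_nth x).
Qed.

Definition tuple_row {R : realType} n (t : n.-tuple R) : 'rV[R]_n :=
  \row_i tnth t i.

(* Lebesgue integral over V of a real-valued function on R^n. *)
Definition lebesgue_int {R : realType} n (V : set 'rV[R]_n)
    (f : 'rV[R]_n -> R) : \bar R :=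
  (\int[lebesgue_tuple n]_(t in [set t | V (tuple_row t)]) (f (tuple_row t))%:E)%E.

(** * Smooth functions of several variables *)

Definition partial {R : realType} n (k : 'I_n) (f : 'rV[R]_n -> R) :
    'rV[R]_n -> R :=
  'D_(delta_mx 0 k) f.

Definition partials {R : realType} n (s : seq 'I_n) (f : 'rV[R]_n -> R) :
    'rV[R]_n -> R :=
  foldr (@partial R n) f s.

Definition smooth_open {R : realType} n (U : set 'rV[R]_n)
    (f : 'rV[R]_n -> R) : Prop :=
  forall s x, U x ->
    {for x, continuous (partials s f)} /\
    forall k : 'I_n, derivable (partials s f) x (delta_mx 0 k).

(* Smoothness on an arbitrary subset D (below, a relatively open subset of the
   half-space): local existence of smooth extensions. *)
Definition smooth_on {R : realType} n (D : set 'rV[R]_n)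
    (f : 'rV[R]_n -> R) : Prop :=
  forall x, D x -> exists U F,
    [/\ open U, U x, smooth_open U F & forall y, U y -> D y -> F y = f y].

(* J is the Jacobian matrix at x of the restriction of f to D, in the row-vector
   convention f(x + h) = f(x) + h J + o(|h|); J is unique when D is relatively
   open in the half-space. *)
Definition is_jacobian {R : realType} n m (D : set 'rV[R]_n)
    (f : 'rV[R]_n -> 'rV[R]_m) (x : 'rV[R]_n) (J : 'M[R]_(n, m)) : Prop :=
  forall e : R, 0 < e -> \forall y \near within D (nbhs x),
    `|f y - f x - (y - x) *m J| <= e * `|y - x|.

Definition test_function {R : realType} n (V : set 'rV[R]_n)
    (f : 'rV[R]_n -> R) : Prop :=
  smooth_open setT f /\
  exists K, [/\ compact K, K `<=` V & forall x, ~ K x -> f x = 0].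

(** * Manifolds with boundary *)

Notation borel T := (g_sigma_algebraType (@open T)).

Definition half_space {R : realType} n : set 'rV[R]_n.+1 :=
  [set x | 0 <= x 0 0].

(* A smooth atlas modelled on the closed half-space. Manifolds with boundary
   have positive dimension, written n.+1. [chart_at] selects a chart around
   each point. *)
Record smooth_atlas (R : realType) (n : nat) (T : ptopologicalType) := {
  chart : Type ;
  dom : chart -> set T ;
  coords : chart -> T -> 'rV[R]_n.+1 ;
  param : chart -> 'rV[R]_n.+1 -> T ;
  chart_at : T -> chart ;
  dom_chart_at : forall p, dom (chart_at p) p ;
  open_dom : forall i, open (dom i) ;
  coordK : forall i p, dom i p -> param i (coords i p) = p ;
  coord_image : forall i, exists2 U : set 'rV[R]_n.+1,
    open U & coords i @` dom i = U `&` @half_space R n ;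
  coord_continuous : forall i, {within dom i, continuous (coords i)} ;
  param_continuous : forall i,
    {within coords i @` dom i, continuous (param i)} ;
  transition_smooth : forall i j (k : 'I_n.+1),
    smooth_on (coords i @` (dom i `&` dom j))
      (fun x => coords j (param i x) 0 k)
}.

Section manifold.
Context {R : realType} {n : nat} {T : ptopologicalType}.
Variable M : smooth_atlas R n T.

Definition mboundary : set T :=
  [set p | exists2 i : chart M, dom i p & coords i p 0 0 = 0].

Definition minterior : set T := ~` mboundary.

Definition coord_range (i : chart M) : set 'rV[R]_n.+1 := coords i @` dom i.

Definition coord_interior (i : chart M) : set 'rV[R]_n.+1 :=
  coords i @` (dom i `&` minterior).

Definition is_transition_jacobian (i j : chart M) (p : T)
    (J : 'M[R]_n.+1) : Prop :=
  is_jacobian (coords i @` (dom i `&` dom j)) (coords j \o param i) (coords i p) J.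

Definition smooth (f : T -> R) : Prop :=
  forall i : chart M, smooth_on (coord_range i) (f \o param i).

(* C_c^oo(M) for the interior M. *)
Definition smooth_compact_support (f : T -> R) : Prop :=
  smooth f /\
  exists K, [/\ compact K, K `<=` minterior & forall p, ~ K p -> f p = 0].

(* [gram i p] is the Gram matrix of the metric at p in the basis of T_pM given
   by chart i; it is only meaningful for p in [dom i]. The same convention is
   used for the components of vector and covector fields below. *)
Record riemannian_metric := {
  gram : chart M -> T -> 'M[R]_n.+1 ;
  gram_sym : forall i p, dom i p -> (gram i p)^T = gram i p ;
  gram_posdef : forall i p (v : 'rV[R]_n.+1), dom i p -> v != 0 ->
    0 < (v *m gram i p *m v^T) 0 0 ;
  gram_smooth : forall i (k l : 'I_n.+1),
    smooth_on (coord_range i) (fun x => gram i (param i x) k l) ;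
  gram_transition : forall i j p J, dom i p -> dom j p ->
    is_transition_jacobian i j p J -> gram i p = J *m gram j p *m J^T
}.

(* Smooth vector fields on the whole manifold, boundary included. *)
Record vector_field := {
  vcomp : chart M -> T -> 'rV[R]_n.+1 ;
  vcomp_smooth : forall i (k : 'I_n.+1),
    smooth_on (coord_range i) (fun x => vcomp i (param i x) 0 k) ;
  vcomp_transition : forall i j p J, dom i p -> dom j p ->
    is_transition_jacobian i j p J -> vcomp j p = vcomp i p *m J
}.

(* Covector fields (sections of T^*M) over the interior, without regularity. *)
Record covector_field := {
  ccomp : chart M -> T -> 'rV[R]_n.+1 ;
  ccomp_transition : forall i j p J, dom i p -> dom j p -> minterior p ->
    is_transition_jacobian i j p J -> ccomp i p = ccomp j p *m J^T
}.

(* Differential operators of order at most 1 on functions, with smooth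
   coefficients up to the boundary: u |-> X u + a u. *)
Record diff_operator1 := {
  op_vector : vector_field ;
  op_zeroth : T -> R ;
  op_zeroth_smooth : smooth op_zeroth
}.

(* P u = w on M in the sense of distributions. In each chart, P reads
   sum_k b_k d_k + a, with formal transpose f |-> a f - sum_k d_k (b_k f). *)
Definition distr_apply (P : diff_operator1) (u w : T -> R) : Prop :=
  forall (i : chart M) (f : 'rV[R]_n.+1 -> R),
    test_function (coord_interior i) f ->
    lebesgue_int (coord_interior i) (fun x => u (param i x) *
      (op_zeroth P (param i x) * f x -
       \sum_(k < n.+1)
         partial k (fun y => vcomp (op_vector P) i (param i y) 0 k * f y) x)) =
    lebesgue_int (coord_interior i) (fun x => w (param i x) * f x).

(* du = omega on M in the sense of distributions. *)
Definition weak_differential (u : T -> R) (omega : covector_field) : Prop :=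
  forall (i : chart M) (k : 'I_n.+1) (f : 'rV[R]_n.+1 -> R),
    test_function (coord_interior i) f ->
    lebesgue_int (coord_interior i)
      (fun x => ccomp omega i (param i x) 0 k * f x) =
    (- lebesgue_int (coord_interior i)
      (fun x => u (param i x) * partial k f x)%R)%E.

(** * L^2 and Sobolev spaces *)

Local Notation borel := (borel T).

Variable g : riemannian_metric.

(* dmu = sqrt(det g) dx in every chart; since the chart domains cover T, this
   determines mu when T is compact. *)
Definition is_riemannian_volume (mu : {measure set borel -> \bar R}) : Prop :=
  forall (i : chart M) (A : set borel), measurable A -> A `<=` dom i ->
    mu A = lebesgue_int (coords i @` A)
      (fun x => Num.sqrt (\det (gram g i (param i x)))).

(* Squared pointwise norm on T_p^*M, through the inverse Gram matrix. *)
Definition conorm2 (omega : covector_field) (p : T) : R :=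
  let i := chart_at M p in
  (ccomp omega i p *m invmx (gram g i p) *m (ccomp omega i p)^T) 0 0.

Variable mu : {measure set borel -> \bar R}.

Definition L2norm2 (u : T -> R) : \bar R :=
  (\int[mu]_(p in (minterior : set borel)) ((u p) ^+ 2)%:E)%E.

Definition L2 (u : T -> R) : Prop :=
  measurable_fun (minterior : set borel) (u : borel -> R) /\
  (L2norm2 u < +oo)%E.

Definition form_L2norm2 (omega : covector_field) : \bar R :=
  (\int[mu]_(p in (minterior : set borel)) (conorm2 omega p)%:E)%E.

Definition form_L2 (omega : covector_field) : Prop :=
  (forall (i : chart M) (k : 'I_n.+1),
    measurable_fun (dom i `&` minterior : set borel)
      (fun p : borel => ccomp omega i p 0 k)) /\
  (form_L2norm2 omega < +oo)%E.

(* [is_differential u omega]: omega represents du in L^2(M; T^*M). It is unique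
   almost everywhere, and exists for every u in H^1(M). *)
Definition is_differential (u : T -> R) (omega : covector_field) : Prop :=
  form_L2 omega /\ weak_differential u omega.

Definition H1 (u : T -> R) : Prop :=
  L2 u /\ forall P : diff_operator1, exists2 w, L2 w & distr_apply P u w.

(* Closure of C_c^oo(M) in H^1(M) for the Hilbert norm
   (|u|_{L^2}^2 + |du|_{L^2}^2)^{1/2}. *)
Definition H10 (u : T -> R) : Prop :=
  H1 u /\ forall e : R, 0 < e -> exists f omega,
    [/\ smooth_compact_support f, is_differential (u \- f) omega &
        (L2norm2 (u \- f)%R + form_L2norm2 omega < e%:E)%E].

End manifold.

(* Main.v *)
Require Import Defs.
From mathcomp Require Import all_boot all_order all_algebra.
From mathcomp Require Import all_classical all_reals all_analysis.
From mathcomp Require Import measurable_realfun lra ring.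

(* Call an open set W good if [int_W f^2 <= C (|du|^2 + |om|^2)] for all f in
   C_c^oo(M), where du and om are weak differentials of some u and of u - f. In a
   chart, extend f by zero across the boundary and apply the elementary inequality
   [int_Q F^2 <= C (int_S F^2 + int_Q |grad F|^2)] for a box Q and any sub-box S:
   near a boundary point S can be taken outside the half-space, where F = 0, and
   near a limit of points with good neighbourhoods S can be taken inside one of
   them. The gradient is bounded by testing the weak equations against
   [chi d_k F], chi a cutoff of Q. Hence the points with a good neighbourhood form
   a nonempty, open and closed set, and a finite cover makes M good. The theorem
   follows by letting f tend to u. *)

Set Implicit Arguments.
Unset Strict Implicit.
Unset Printing Implicit Defensive.

Import Order.TTheory GRing.Theory Num.Theory.
Import numFieldNormedType.Exports.

Local Open Scope classical_set_scope.
Local Open Scope ring_scope.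

(** * Integrals on boxes of n-tuples *)

(** The data are weak differentials of u and of u - f, never a differential of f. Identifying the
    gradient of f with the difference of the two would need uniqueness of weak derivatives almost
    everywhere, and making it a covector field would need its transition law; so every estimate
    carries the pair (du, om), and only the quadratic bound given by one test function is used. The
    Riemannian measure is likewise only compared with Lebesgue measure, with constants bounding its
    density on a small chart box; no change of variables between charts occurs. A nonzero constant
    has zero gradient, so no estimate without a term on a sub-box can hold in a chart away from the
    boundary. The boundary supplies the first region where this term is controlled, and
    connectedness carries the control everywhere. No rate is tracked along the way: compactness
    alone makes the constant finite. As f tends to u, |om|^2 tends to 0, and u^2 <= 2 (u - f)^2 + 2
    f^2 costs a factor 2. *)

Section nonneg_integrals.
Local Open Scope ereal_scope.
Context d (T : measurableType d) (R : realType).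
Import HBNNSimple.

(** The integral of a nonnegative function is a supremum over the simple functions below it, hence
    monotone without measurability. This matters for [conorm2], whose chart [chart_at M p] varies
    with p in an arbitrary way. *)
Lemma ge0_le_integral_nomeas (mu : {measure set T -> \bar R})
    (A B : set T) (f g : T -> \bar R) :
  A `<=` B -> (forall x, A x -> 0 <= f x) -> (forall x, B x -> 0 <= g x) ->
  (forall x, A x -> f x <= g x) ->
  \int[mu]_(x in A) f x <= \int[mu]_(x in B) g x.
Proof.
move=> AB f0 g0 fg; rewrite (integral_mkcond A) (integral_mkcond B).
have f'0 x : 0 <= (f \_ A) x by rewrite /patch; case: ifPn => // /set_mem /f0.
have g'0 x : 0 <= (g \_ B) x by rewrite /patch; case: ifPn => // /set_mem /g0.
rewrite !ge0_integralE //= ge_ereal_sup// => _ [/= h hf <-].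
apply: le_ereal_sup_tmp; exists (sintegral mu h) => //; exists h => //= x.
apply: le_trans (hf x) _; rewrite /patch !in_setT.
case: ifPn => [/set_mem Ax|_]; last exact: g'0.
by rewrite mem_set; [exact: fg|exact: AB].
Qed.

(** A simple function below f extended by zero has all its nonzero level sets inside D, so it is
    enough to compare the measures on subsets of D. This turns [volume_bounds] into bounds on
    integrals. *)
Lemma le_measure_integral_on (m1 m2 : {measure set T -> \bar R}) (D : set T)
    (f : T -> \bar R) :
  (forall S, measurable S -> S `<=` D -> m1 S <= m2 S) ->
  (forall x, D x -> 0 <= f x) ->
  \int[m1]_(x in D) f x <= \int[m2]_(x in D) f x.
Proof.
move=> m12 f0; rewrite !(integral_mkcond D).
have f'0 x : 0 <= (f \_ D) x by rewrite /patch; case: ifPn => // /set_mem /f0.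
rewrite !ge0_integralE //= ge_ereal_sup// => _ [/= h hf <-].
apply: le_ereal_sup_tmp; exists (sintegral m2 h); first by exists h.
rewrite !sintegralE; apply: lee_fsum; first exact: fimfunP.
move=> r _; have [->|r0] := eqVneq r 0%R; first by rewrite !mul0e.
have [hr|/set0P[x hx]] := eqVneq (h @^-1` [set r]) set0.
  by rewrite hr !measure0.
rewrite lee_wpmul2l//; first by rewrite lee_fin -hx.
apply: m12; first exact: measurable_funPTI.
move=> y /= hy; have := hf y; rewrite /patch in_setT.
case: ifPn => [/set_mem//|_]; rewrite hy lee_fin => rle0.
suff : (r == 0)%R by rewrite (negbTE r0).
by rewrite eq_le rle0 -hx /= fun_ge0.
Qed.

Lemma ge0_integral_mrestr (m : {measure set T -> \bar R}) (E : set T)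
    (mE : measurable E) (D : set T) (f : T -> \bar R) :
  measurable D -> measurable_fun D f -> (forall x, D x -> 0 <= f x) ->
  \int[mrestr m mE]_(x in D) f x = \int[m]_(x in D `&` E) f x.
Proof.
move=> mD mf f0.
have mDE : measurable (D `&` E) by exact: measurableI.
have mDC : measurable (D `\` E) by exact: measurableD.
have -> : \int[mrestr m mE]_(x in D) f x =
    \int[mrestr m mE]_(x in D `&` E) f x + \int[mrestr m mE]_(x in D `\` E) f x.
  rewrite -ge0_integral_setU ?setUIDK//=.
  by apply/disj_setPS => x [[? ?] [? ]].
rewrite [X in _ + X](_ : _ = 0) ?adde0; last first.
  apply: null_set_integral => //.
    by apply: measurable_funS mf => // x [].
  by rewrite /= /mrestr setDE -setIA setICl setI0 measure0.
apply/eqP; rewrite eq_le; apply/andP; split.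
- apply: le_measure_integral_on => [S mS SDE|x [/f0//]].
  by rewrite /= /mrestr setIidl// => x /SDE[].
- apply: le_measure_integral_on => [S mS SDE|x [/f0//]].
  by rewrite /= /mrestr setIidl// => x /SDE[].
Qed.

End nonneg_integrals.

Section tuple_row.
Context (R : realType).

Lemma open_rV_box n (O : set 'rV[R]_n) x : open O -> O x ->
  exists2 e : R, 0 < e & forall y : 'rV[R]_n, (forall k, `|y 0 k - x 0 k| < e) -> O y.
Proof.
move=> oO Ox; have /nbhs_ballP[e /= e0 bO] : nbhs x O by exact: open_nbhs_nbhs.
exists e => // y xy; apply: bO; split => // i j.
by rewrite /ball/= distrC; have := xy j; rewrite !ord1.
Qed.

Lemma tuple_rowE n (t : n.-tuple R) k : tuple_row t 0 k = tnth t k.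
Proof. by rewrite mxE. Qed.

(** The sigma-algebra on tuples is generated by the coordinates, not by a topology, so an open set
    is exhausted by countably many boxes with rational centres and half-widths 1/(m+1). *)
Lemma open_tuple_measurable n (O : set 'rV[R]_n) : open O ->
  measurable [set t : n.-tuple (measurableTypeR R) | O (tuple_row t)].
Proof.
move=> oO.
pose B (q : n.-tuple rat) (m : nat) := [set t : n.-tuple (measurableTypeR R) |
  forall k, tnth t k \in `]ratr (tnth q k) - m.+1%:R^-1, ratr (tnth q k) + m.+1%:R^-1[%R].
pose P := [set qm : n.-tuple rat * nat | B qm.1 qm.2 `<=` [set t | O (tuple_row t)]].
have mB q m : measurable (B q m).
  rewrite (_ : B q m = \bigcap_(k in [set: 'I_n]) ((fun t : n.-tuple (measurableTypeR R) => tnth t k) @^-1` `]ratr (tnth q k) - m.+1%:R^-1, ratr (tnth q k) + m.+1%:R^-1[%classic)).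
    apply: fin_bigcap_measurable; first exact: finite_finset.
    move=> i _; rewrite -[X in measurable X]setTI; apply: measurable_tnth => //; exact: measurable_itv.
  by apply/seteqP; split=> t h k; [move=> _; exact: h|exact: (h k I)].
rewrite (_ : [set _ | _] = \bigcup_(qm in P) B qm.1 qm.2).
  rewrite bigcup_mkcond; apply: countable_bigcupT_measurable => // -[q m].
  by case: ifP.
apply/seteqP; split => [t Ot|t [[q m] Pqm] /Pqm//].
have [e e0 He] := open_rV_box oO Ot.
(* Two points of one box differ by less than 2/(m+1) in each coordinate. *)
have [m me] : exists m : nat, m.+1%:R^-1 < e / 2.
  have /ltr_add_invr[m] : 0 < e / 2 by lra.
  by rewrite add0r => ?; exists m.
have qP k : exists q : rat, (ratr q : R) \in `]tnth t k - m.+1%:R^-1, tnth t k + m.+1%:R^-1[%R.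
  apply: rat_in_itvoo; rewrite ltrD2l gtrN //.
move/choice : qP => [qf qP].
pose q := [tuple qf k | k < n].
exists (q, m).
  move=> s /= Bs; apply: He => k; rewrite !tuple_rowE.
  have := Bs k; rewrite tnth_mktuple; have := qP k.
  rewrite !in_itv /= ltr_norml; move: (m.+1%:R^-1 : R) (ratr (qf k) : R) me (tnth t k : R) (tnth s k : R).
  by move=> d q' ? t' s' /andP[? ?] /andP[? ?]; lra.
move=> k /=; rewrite tnth_mktuple; have := qP k.
rewrite !in_itv /=; move: (m.+1%:R^-1 : R) (ratr (qf k) : R) (tnth t k : R).
by move=> d q' t' /andP[? ?]; lra.
Qed.

Lemma continuous_tuple_measurable n (U : set 'rV[R]_n) (f : 'rV[R]_n -> R) :
  open U -> (forall x, U x -> {for x, continuous f}) ->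
  measurable_fun [set t : n.-tuple (measurableTypeR R) | U (tuple_row t)]
    (fun t => f (tuple_row t)).
Proof.
move=> oU cf; apply: (measurability _ (RGenOpens.measurableE R)) => _ [_ [a [b ->] <-]].
rewrite (_ : _ `&` _ = [set t | (U `&` f @^-1` `]a, b[%classic) (tuple_row t)])//.
apply: open_tuple_measurable; rewrite openE => x [Ux fx]; apply: filterI.
  exact: open_nbhs_nbhs.
have /(cf x Ux) : nbhs (f x) `]a, b[%classic by exact: open_nbhs_nbhs.
by [].
Qed.

End tuple_row.

(** * The Poincaré inequality on an interval *)

Section one_dimension.
Context (R : realType).
Local Notation leb := (@lebesgue_measure R).

Lemma continuous_itv_measurable (f : R -> R) (a b : R) :
  (forall x, a <= x <= b -> {for x, continuous f}) ->
  measurable_fun (`[a, b]%classic : set (measurableTypeR R)) f.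
Proof.
move=> cf; apply: subspace_continuous_measurable_fun => //.
by apply: continuous_in_subspaceT => x; rewrite inE /= in_itv /=; exact: cf.
Qed.

Lemma integral_derive_itv (f g : R -> R) (a b : R) : a <= b ->
  (forall x, a <= x <= b -> is_derive x 1 f (g x)) ->
  (forall x, a <= x <= b -> {for x, continuous g}) ->
  (\int[leb]_(x in `[a, b]) (g x)%:E = (f b - f a)%:E)%E.
Proof.
rewrite le_eqVlt => /predU1P[<-|ab] df cg.
  by rewrite set_itv1 integral_set1 subrr.
have cf x : a <= x <= b -> {for x, continuous f}.
  move=> /df fx; apply/differentiable_continuous/derivable1_diffP.
  by case: fx.
rewrite (@continuous_FTC2 _ g f)//.
- by apply: continuous_in_subspaceT => x; rewrite inE /= in_itv /=; exact: cg.
- split.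
  + by move=> x; rewrite in_itv /= => /andP[ax xb]; have [] := df x; rewrite ?ltW.
  + by apply: cvg_at_right_filter; apply: cf; rewrite lexx ltW.
  + by apply: cvg_at_left_filter; apply: cf; rewrite lexx ltW.
- move=> x; rewrite in_itv /= => /andP[ax xb]; rewrite derive1E.
  by apply: derive_val; apply: df; rewrite ?ltW.
Qed.

(* [g^2 >= 2 c g - c^2], whose primitive [2 c f - c^2 id] increases by
   [(f y - f x)^2 / (y - x)] for [c = (f y - f x) / (y - x)]. *)
Lemma increment_le_integral (f g : R -> R) (a b x y : R) :
  (forall x, a <= x <= b -> is_derive x 1 f (g x)) ->
  (forall x, a <= x <= b -> {for x, continuous g}) ->
  a <= x <= b -> a <= y <= b ->
  (((f y - f x) ^+ 2)%:E <=
     (b - a)%:E * \int[leb]_(z in `[a, b]) (g z ^+ 2)%:E)%E.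
Proof.
move=> df cg.
wlog xy : x y / x <= y.
  by move=> H hx hy; case: (leP x y) => [|/ltW] xy; [|rewrite -sqrrN opprB]; exact: H.
move=> /andP[ax xb] /andP[ay yb].
have g2_ge0 z : (0 <= (g z ^+ 2)%:E)%E by rewrite lee_fin sqr_ge0.
move: (xy); rewrite le_eqVlt => /predU1P[->|ltxy].
  rewrite subrr expr0n /= mule_ge0 ?lee_fin ?subr_ge0 ?(le_trans ax)//.
  exact: integral_ge0.
pose c := (f y - f x) / (y - x).
have yx0 : y - x != 0 by rewrite subr_eq0 gt_eqF.
have dh z : x <= z <= y -> is_derive z 1 (fun z => 2 * c * f z - c ^+ 2 * z) (2 * c * g z - c ^+ 2).
  move=> /andP[xz zy]; have dfz := df z.
  have {}dfz : is_derive z 1 f (g z) by apply: dfz; rewrite (le_trans ax)//= (le_trans zy).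
  by apply: is_derive_eq; rewrite /GRing.scale /= mulr1.
have sub : `[x, y] `<=` `[a, b] by move=> z /=; rewrite !in_itv /= => /andP[xz zy]; rewrite (le_trans ax)//= (le_trans zy).
have mg : measurable_fun (`[a, b]%classic : set (measurableTypeR R)) (EFin \o (fun z => g z ^+ 2)).
  apply/measurable_EFinP; apply: measurable_funX; exact: continuous_itv_measurable.
have : (((f y - f x) ^+ 2 / (y - x))%:E <= \int[leb]_(z in `[a, b]) (g z ^+ 2)%:E)%E.
  have -> : (f y - f x) ^+ 2 / (y - x) =
      (2 * c * f y - c ^+ 2 * y) - (2 * c * f x - c ^+ 2 * x).
    rewrite /c; field; exact: yx0.
  have cgxy z : x <= z <= y -> {for z, continuous g}.
    by move=> /andP[xz zy]; apply: cg; rewrite (le_trans ax)//= (le_trans zy).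
  have ch z : x <= z <= y -> {for z, continuous (fun z => 2 * c * g z - c ^+ 2)}.
    by move=> /cgxy ?; apply: cvgB; [apply: cvgM => //; exact: cvg_cst|exact: cvg_cst].
  rewrite -(@integral_derive_itv (fun z => 2 * c * f z - c ^+ 2 * z) (fun z => 2 * c * g z - c ^+ 2))//.
  apply: (@le_trans _ _ (\int[leb]_(z in `[x, y]) (g z ^+ 2)%:E)%E).
    apply: le_integral => //.
    - apply: continuous_compact_integrable; first exact: segment_compact.
      by apply: continuous_in_subspaceT => z; rewrite inE /= in_itv /=; exact: ch.
    - apply: continuous_compact_integrable; first exact: segment_compact.
      apply: continuous_in_subspaceT => z; rewrite inE /= in_itv /= => /cgxy ?.
      by apply: cvgM.
    - by move=> z _; rewrite lee_fin -subr_ge0 (_ : _ - _ = (g z - c) ^+ 2) ?sqr_ge0//; ring.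
  by apply: ge0_subset_integral.
have ab0 : (0 <= (b - a)%:E)%E by rewrite lee_fin subr_ge0 (le_trans ax).
move=> /(lee_wpmul2l ab0); apply: le_trans.
rewrite -EFinM lee_fin mulrCA ler_peMr ?sqr_ge0//.
by rewrite ler_pdivlMr ?subr_gt0// mul1r lerB.
Qed.

(** For y in [c, d], f(x)^2 <= 2 f(y)^2 + 2 (f(x) - f(y))^2, and the increment is controlled by
    [increment_le_integral]. Averaging over y gives a pointwise bound on f(x)^2; integrating it over
    [a, b] gives the two terms of the constant. *)
Lemma poincare_itv (a b c d : R) : a <= c -> c < d -> d <= b ->
  exists2 C : R, 0 < C & forall f g : R -> R,
    (forall x, a <= x <= b -> is_derive x 1 f (g x)) ->
    (forall x, a <= x <= b -> {for x, continuous g}) ->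
    (\int[leb]_(x in `[a, b]) (f x ^+ 2)%:E <=
     C%:E * (\int[leb]_(x in `[c, d]) (f x ^+ 2)%:E +
             \int[leb]_(x in `[a, b]) (g x ^+ 2)%:E))%E.
Proof.
move=> ac cd db; have dc0 : 0 < d - c by rewrite subr_gt0.
have ba0 : 0 < b - a by lra.
have C10 : 0 < 2 * (b - a) / (d - c) by rewrite divr_gt0// mulr_gt0.
have C20 : 0 < 2 * (b - a) ^+ 2 by rewrite mulr_gt0// exprn_gt0.
exists (2 * (b - a) / (d - c) + 2 * (b - a) ^+ 2); first exact: addr_gt0.
move=> f g df cg; set K := _ + _; have K0 : 0 < K by exact: addr_gt0.
have cf x : a <= x <= b -> {for x, continuous f}.
  move=> /df fx; apply/differentiable_continuous/derivable1_diffP.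
  by case: fx.
have mf2 u v : a <= u -> v <= b ->
    measurable_fun (`[u, v]%classic : set (measurableTypeR R)) (fun x => (f x ^+ 2)%:E).
  move=> au vb; apply/measurable_EFinP; apply: measurable_funX.
  by apply: continuous_itv_measurable => x /andP[ux xv]; apply: cf; lra.
have lenJ z : (\int[leb]_(y in `[c, d]) z%:E = (z * (d - c))%:E)%E.
  rewrite integral_cst//= EFinM; congr (_ * _)%E; have := lebesgue_measure_itv `[c, d]%R.
  by rewrite /= lte_fin cd EFinB.
have lenI z : (\int[leb]_(y in `[a, b]) z%:E = (z * (b - a))%:E)%E.
  rewrite integral_cst//= EFinM; congr (_ * _)%E; have := lebesgue_measure_itv `[a, b]%R.
  by rewrite /= lte_fin -subr_gt0 ba0 EFinB.
set B := (\int[leb]_(x in `[c, d]) _)%E; set A := (\int[leb]_(x in `[a, b]) (g x ^+ 2)%:E)%E.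
have B0 : (0 <= B)%E by apply: integral_ge0 => x _; rewrite lee_fin sqr_ge0.
have A0 : (0 <= A)%E by apply: integral_ge0 => x _; rewrite lee_fin sqr_ge0.
(* An infinite integral makes the right-hand side infinite; afterwards both are real numbers r and
   q. *)
case EA : A A0 => [r| |] A0 //; last first.
  by rewrite addey ?gt0_muley ?leey ?lte_fin// -ltNye (lt_le_trans _ B0)// ltNyr.
case EB : B B0 => [q| |] B0 //; last by rewrite addye// gt0_muley ?leey ?lte_fin.
rewrite !lee_fin in A0 B0.
(* The mean over y in [c, d], obtained by writing f(x)^2 (d - c) as an integral over [c, d]. *)
have pt x : a <= x <= b -> f x ^+ 2 <= 2 / (d - c) * q + 2 * (b - a) * r.
  move=> xab.
  suff : ((f x ^+ 2 * (d - c))%:E <= (2 * q + 2 * (b - a) * r * (d - c))%:E)%E.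
    rewrite lee_fin -ler_pdivlMr// => /le_trans; apply; rewrite le_eqVlt; apply/orP; left.
    by apply/eqP; field; rewrite gt_eqF.
  rewrite -lenJ.
  rewrite [leRHS](_ : _ = \int[leb]_(y in `[c, d]) (2 * f y ^+ 2 + 2 * (b - a) * r)%:E)%E; last first.
    under eq_integral do rewrite EFinD EFinM.
    rewrite ge0_integralD//=.
    - rewrite ge0_integralZl//=.
      + by rewrite -/B EB lenJ -EFinM -EFinD.
      + exact: mf2.
      + by move=> y _; rewrite lee_fin sqr_ge0.
    - by move=> y _; rewrite -EFinM lee_fin mulr_ge0// sqr_ge0.
    - by apply: emeasurable_funM => //; exact: mf2.
    - by move=> y _; rewrite lee_fin mulr_ge0// mulr_ge0// ltW.
  apply: ge0_le_integral => //=.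
  - by move=> y _; rewrite lee_fin sqr_ge0.
  - apply/measurable_EFinP; apply: measurable_funD => //.
    by apply: measurable_funM => //; apply/measurable_EFinP; exact: mf2.
  - move=> y; rewrite in_itv /= => /andP[cy yd].
    have yab : a <= y <= b by lra.
    have := increment_le_integral df cg yab xab; rewrite -/A EA -EFinM !lee_fin => H.
    (* This square is the defect in f(x)^2 <= 2 f(y)^2 + 2 (f(x) - f(y))^2. *)
    have H2 : 0 <= (f x - 2 * f y) ^+ 2 by rewrite sqr_ge0.
    by rewrite -mulrA; nra.
apply: (@le_trans _ _ (\int[leb]_(x in `[a, b]) (2 / (d - c) * q + 2 * (b - a) * r)%:E)%E).
  apply: ge0_le_integral => //=.
  - by move=> y _; rewrite lee_fin sqr_ge0.
  - exact: mf2.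
rewrite lenI -EFinD -EFinM lee_fin.
rewrite [leLHS](_ : _ = 2 * (b - a) / (d - c) * q + 2 * (b - a) ^+ 2 * r); last by field; rewrite gt_eqF.
rewrite (mulrDr K) lerD //; apply: ler_wpM2r => //; rewrite /K; lra.
Qed.

End one_dimension.

(** * Boxes and iterated integrals *)

Section boxes.
Context (R : realType).
Local Notation leb := (@lebesgue_measure R).
Local Notation tup n := (n.-tuple (measurableTypeR R)).

(** The bounds are sequences on [nat], so that dropping the first coordinate is composition with
    [succn], whatever the dimension. *)
Definition cbox n (a b : nat -> R) : set (tup n) :=
  [set t | forall i : 'I_n, a i <= tnth t i <= b i].

Arguments cbox : clear implicits.

Lemma cboxE n (a b : nat -> R) : cbox n a b =
  [set t : tup n | forall i : 'I_n, `[a i, b i]%classic (tnth t i)].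
Proof.
by apply/seteqP; split => t h i; have := h i; rewrite /= in_itv.
Qed.

Lemma measurable_cbox n (a b : nat -> R) : measurable (cbox n a b).
Proof.
rewrite (_ : cbox n a b = \bigcap_(k in [set: 'I_n]) ((fun t : tup n => tnth t k) @^-1` `[a k, b k]%classic)).
  apply: fin_bigcap_measurable; first exact: finite_finset.
  move=> i _; rewrite -[X in measurable X]setTI; apply: measurable_tnth => //; exact: measurable_itv.
rewrite cboxE.
by apply/seteqP; split=> t h k; [move=> _; exact: h|exact: (h k I)].
Qed.

Lemma cbox_cons n (a b : nat -> R) x (t : tup n) :
  cbox n.+1 a b (tuple_cons (x, t)) <->
  (`[a 0%N, b 0%N]%classic x /\ cbox n (a \o succn) (b \o succn) t).
Proof.
split=> [h|[hx ht] i].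
  split=> [|i]; first by have := h ord0; rewrite (tnth_nth x) /= in_itv.
  by have := h (lift ord0 i); rewrite !(tnth_nth x).
case: (unliftP ord0 i) => [j ->|->].
  by have := ht j; rewrite !(tnth_nth x).
by rewrite (tnth_nth x) /=; move: hx; rewrite /= in_itv.
Qed.

Section tonelli.
Local Open Scope ereal_scope.
Variables (n : nat) (a b : nat -> R) (f : tup n.+1 -> \bar R).
Hypothesis mf : measurable_fun (cbox n.+1 a b) f.
Local Notation a' := (a \o succn).
Local Notation b' := (b \o succn).
Local Notation lam := (lebesgue_tuple n).

(** The measure is a pushforward along [tuple_cons]; f, extended by zero off the box, is pulled back
    to the product, where the theorems of Fubini and Tonelli apply. *)
Let h : measurableTypeR R * tup n -> \bar R := (f \_ (cbox n.+1 a b)) \o @tuple_cons _ n.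

Let mfD : measurable_fun setT (f \_ (cbox n.+1 a b)).
Proof. by apply/(measurable_restrictT _ _).1 => //; exact: measurable_cbox. Qed.

Let mh : measurable_fun setT h.
Proof. by apply: measurableT_comp mfD _; exact: measurable_tuple_cons. Qed.

Let hE x t : h (x, t) = ((fun x => ((fun t => f (tuple_cons (x, t))) \_ (cbox n a' b')) t) \_ `[a 0%N, b 0%N]) x.
Proof.
rewrite /h /= /patch; case: ifPn => [/set_mem /cbox_cons[hx ht]|].
  by rewrite !mem_set.
case: ifPn => // /set_mem hx; case: ifPn => // /set_mem ht.
by move/negP; elim; apply/mem_set/cbox_cons.
Qed.

Let int_h1 x : \int[lam]_t h (x, t) =
  ((fun x => \int[lam]_(t in cbox n a' b') f (tuple_cons (x, t))) \_ `[a 0%N, b 0%N]) x.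
Proof.
under eq_integral do rewrite hE.
rewrite /patch; case: ifPn => _; last by rewrite integral0.
by rewrite [in RHS]integral_mkcond.
Qed.

Let int_h2 t : \int[leb]_x h (x, t) =
  ((fun t => \int[leb]_(x in `[a 0%N, b 0%N]) f (tuple_cons (x, t))) \_ (cbox n a' b')) t.
Proof.
under eq_integral do rewrite hE.
rewrite -integral_mkcond /patch; case: ifPn => // _.
by rewrite integral0.
Qed.

Section integrable.
Hypothesis fi : (lebesgue_tuple n.+1).-integrable (cbox n.+1 a b) f.

Let ih : (leb \x lam).-integrable setT h.
Proof.
have /integrableP[_ fDi] := (integrable_mkcond f (@measurable_cbox n.+1 a b)).1 fi.
apply/integrableP; split => //; apply: le_lt_trans fDi.
rewrite le_eqVlt; apply/orP; left; apply/eqP/esym.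
apply: (ge0_integral_pushforward (@measurable_tuple_cons R n)) => //.
exact: measurableT_comp.
Qed.

Let int_hi : \int[lebesgue_tuple n.+1]_(t in cbox n.+1 a b) f t = \int[leb \x lam]_z h z.
Proof.
rewrite integral_mkcond.
exact: (integral_pushforward (@measurable_tuple_cons R n)).
Qed.

Lemma integral_cbox_fubini1 :
  \int[lebesgue_tuple n.+1]_(t in cbox n.+1 a b) f t =
  \int[leb]_(x in `[a 0%N, b 0%N]) \int[lam]_(t in cbox n a' b') f (tuple_cons (x, t)).
Proof.
rewrite int_hi -integral12_prod_meas1// [in RHS]integral_mkcond.
by apply: eq_integral => x _; rewrite -int_h1.
Qed.

Lemma integral_cbox_fubini2 :
  \int[lebesgue_tuple n.+1]_(t in cbox n.+1 a b) f t =
  \int[lam]_(t in cbox n a' b') \int[leb]_(x in `[a 0%N, b 0%N]) f (tuple_cons (x, t)).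
Proof.
rewrite int_hi -integral21_prod_meas1// [in RHS]integral_mkcond.
by apply: eq_integral => x _; rewrite -int_h2.
Qed.

End integrable.

Hypothesis f0 : forall t, cbox n.+1 a b t -> 0 <= f t.

Let h0 z : 0 <= h z.
Proof. by rewrite /h /= /patch; case: ifPn => // /set_mem /f0. Qed.

Let int_h : \int[lebesgue_tuple n.+1]_(t in cbox n.+1 a b) f t = \int[leb \x lam]_z h z.
Proof.
rewrite integral_mkcond.
apply: (ge0_integral_pushforward (@measurable_tuple_cons R n)) => //.
by move=> t _; rewrite /patch; case: ifPn => // /set_mem /f0.
Qed.

Lemma integral_cbox_tonelli1 : \int[lebesgue_tuple n.+1]_(t in cbox n.+1 a b) f t =
  \int[leb]_(x in `[a 0%N, b 0%N]) \int[lam]_(t in cbox n a' b') f (tuple_cons (x, t)).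
Proof.
rewrite int_h fubini_tonelli1// [in RHS]integral_mkcond.
by apply: eq_integral => x _; rewrite -int_h1.
Qed.

Lemma integral_cbox_tonelli2 : \int[lebesgue_tuple n.+1]_(t in cbox n.+1 a b) f t =
  \int[lam]_(t in cbox n a' b') \int[leb]_(x in `[a 0%N, b 0%N]) f (tuple_cons (x, t)).
Proof.
rewrite int_h fubini_tonelli2// [in RHS]integral_mkcond.
by apply: eq_integral => x _; rewrite -int_h2.
Qed.

Lemma measurable_cbox_tonelli1 :
  measurable_fun (`[a 0%N, b 0%N]%classic : set (measurableTypeR R))
    (fun x => \int[lam]_(t in cbox n a' b') f (tuple_cons (x, t))).
Proof.
apply/(measurable_restrictT _ _) => //.
rewrite [X in measurable_fun _ X](_ : _ = fun x => \int[lam]_t h (x, t)); last first.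
  by apply/funext => x; rewrite int_h1.
exact: measurable_fun_fubini_tonelli_F.
Qed.

Lemma measurable_cbox_tonelli2 :
  measurable_fun (cbox n a' b')
    (fun t => \int[leb]_(x in `[a 0%N, b 0%N]) f (tuple_cons (x, t))).
Proof.
apply/(measurable_restrictT _ _) => //; first exact: measurable_cbox.
rewrite [X in measurable_fun _ X](_ : _ = fun t => \int[leb]_x h (x, t)); last first.
  by apply/funext => x; rewrite int_h2.
exact: measurable_fun_fubini_tonelli_G.
Qed.

End tonelli.

Lemma cbox_lt_pinfty n (a b : nat -> R) : (forall i, a i <= b i) ->
  (lebesgue_tuple n (cbox n a b) < +oo)%E.
Proof. by move=> ab; rewrite cboxE lebesgue_tuple_box// ltry. Qed.

Lemma cbox_bounded_integrable n (a b : nat -> R) (f : tup n -> R) (m : R) :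
  (forall i, a i <= b i) -> measurable_fun (cbox n a b) f ->
  (forall t, cbox n a b t -> `|f t| <= m) ->
  (lebesgue_tuple n).-integrable (cbox n a b) (EFin \o f).
Proof.
move=> ab mf fm; apply: measurable_bounded_integrable => //.
- exact: measurable_cbox.
- exact: cbox_lt_pinfty.
- by exists m; split; [exact: num_real|move=> x mx t /fm /le_trans; apply; exact: ltW].
Qed.
End boxes.
Arguments cbox {R} n a b.

(** * Integration and the Poincaré inequality on boxes, along coordinate lines *)

Section lines.
Context (R : realType).
Local Notation leb := (@lebesgue_measure R).
Local Notation tup n := (n.-tuple (measurableTypeR R)).

Definition upd n (t : tup n) (k : 'I_n) (s : R) : tup n :=
  [tuple if i == k then s else tnth t i | i < n].

Lemma upd_cons0 n x (t : tup n) s :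
  upd (tuple_cons (x, t)) ord0 s = tuple_cons (s, t).
Proof.
apply: eq_from_tnth => i; rewrite tnth_mktuple.
case: (unliftP ord0 i) => [j ->|->] /=; first by rewrite !(tnth_nth s).
by rewrite (tnth_nth s).
Qed.

Lemma upd_consS n x (t : tup n) k s :
  upd (tuple_cons (x, t)) (lift ord0 k) s = tuple_cons (x, upd t k s).
Proof.
apply: eq_from_tnth => i; rewrite tnth_mktuple.
case: (unliftP ord0 i) => [j ->|->] /=; last by rewrite !(tnth_nth s).
rewrite !(tnth_nth s) /= (inj_eq (@lift_inj _ ord0)) -[RHS]/(nth s (upd t k s) j).
by rewrite -[RHS]tnth_nth tnth_mktuple (tnth_nth s).
Qed.

(** Regularity is asked along coordinate lines only: this is what the one-dimensional results
    consume, and it is inherited by slices, which the inductions on n require. *)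
Definition line_C1 n (a b : nat -> R) (F : tup n -> R) (G : 'I_n -> tup n -> R) :=
  forall t k, cbox n a b t ->
    is_derive (tnth t k : R) 1 (fun s : R => F (upd t k s)) (G k t) /\
    {for (tnth t k : R), continuous (fun s : R => G k (upd t k s))}.

Lemma line_C1_head n a b (F : tup n.+1 -> R) G t :
  line_C1 a b F G -> cbox n (a \o succn) (b \o succn) t ->
  forall x, a 0%N <= x <= b 0%N ->
    is_derive (x : R) 1 (fun s : R => F (tuple_cons (s, t)))
      (G ord0 (tuple_cons (x, t))) /\
    {for x, continuous (fun s : R => G ord0 (tuple_cons (s, t)))}.
Proof.
move=> FG ht x hx.
have /(FG _ ord0) : cbox n.+1 a b (tuple_cons (x, t)).
  by apply/cbox_cons; rewrite /= in_itv.
rewrite (tnth_nth x) /=.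
under eq_fun do rewrite upd_cons0.
by under [fun s => G _ (upd _ _ _)]eq_fun do rewrite upd_cons0.
Qed.

Lemma line_C1_tail n a b (F : tup n.+1 -> R) G x :
  line_C1 a b F G -> a 0%N <= x <= b 0%N ->
  line_C1 (a \o succn) (b \o succn) (fun t => F (tuple_cons (x, t)))
    (fun k t => G (lift ord0 k) (tuple_cons (x, t))).
Proof.
move=> FG hx t k ht.
have /(FG _ (lift ord0 k)) : cbox n.+1 a b (tuple_cons (x, t)).
  by apply/cbox_cons; rewrite /= in_itv.
rewrite (tnth_nth x) /= -!tnth_nth.
under eq_fun do rewrite upd_consS.
by under [fun s => G _ (upd _ _ _)]eq_fun do rewrite upd_consS.
Qed.

Lemma measurable_cbox_tail n a b (F : tup n.+1 -> R) x :
  measurable_fun (cbox n.+1 a b) F -> a 0%N <= x <= b 0%N ->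
  measurable_fun (cbox n (a \o succn) (b \o succn)) (fun t => F (tuple_cons (x, t))).
Proof.
move=> mF hx.
have -> : (fun t => F (tuple_cons (x, t))) = F \o (fun t => tuple_cons (x, t)) by [].
apply: (measurable_comp (F := cbox n.+1 a b)) => //.
- exact: measurable_cbox.
- by move=> _ [t ht <-]; apply/cbox_cons; rewrite /= in_itv.
- apply: (measurableT_comp (@measurable_tuple_cons R n)).
  exact/measurable_funTS/measurable_pair1.
Qed.

(** Fubini isolates the k-th variable, in which the integral is F at one end minus F at the other.
    Applied to a product, this is integration by parts without boundary terms. *)
Lemma cbox_integral_derive0 n (k : 'I_n) (a b : nat -> R) (F : tup n -> R)
    (G : 'I_n -> tup n -> R) (m : R) :
  (forall i, a i <= b i) ->
  measurable_fun (cbox n a b) (G k) ->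
  (forall t, cbox n a b t -> `|G k t| <= m) ->
  line_C1 a b F G ->
  (forall t, cbox n a b t -> F (upd t k (a k)) = 0 /\ F (upd t k (b k)) = 0) ->
  (\int[lebesgue_tuple n]_(t in cbox n a b) (G k t)%:E = 0)%E.
Proof.
elim: n k a b F G => [[]//|n IH] k a b F G ab mG Gm FG F0.
have iG := cbox_bounded_integrable ab mG Gm.
case: (unliftP ord0 k) => [j|] kE; last first.
  rewrite integral_cbox_fubini2 //; last exact/measurable_EFinP.
  rewrite -[RHS](@integral0 _ _ _ (lebesgue_tuple n) (cbox n (a \o succn) (b \o succn))).
  apply: eq_integral => t /set_mem ht; subst k.
  rewrite (integral_derive_itv (ab 0%N) (fun x hx => (line_C1_head FG ht hx).1)
    (fun x hx => (line_C1_head FG ht hx).2)).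
  have [] := F0 (tuple_cons (a 0%N, t)).
    by apply/cbox_cons; rewrite /= in_itv /= lexx ab.
  by rewrite !upd_cons0 => -> ->; rewrite subrr.
rewrite integral_cbox_fubini1//; last exact/measurable_EFinP.
rewrite -[RHS](@integral0 _ _ _ leb `[a 0%N, b 0%N]%classic).
apply: eq_integral => x; rewrite inE /= in_itv /= => hx.
have hc t : cbox n (a \o succn) (b \o succn) t -> cbox n.+1 a b (tuple_cons (x, t)).
  by move=> ht; apply/cbox_cons; rewrite /= in_itv.
have := IH j (a \o succn) (b \o succn) (fun t => F (tuple_cons (x, t))) (fun k t => G (lift ord0 k) (tuple_cons (x, t))).
rewrite -kE; apply => //.
- by move=> i; exact: ab.
- by have := measurable_cbox_tail mG hx; rewrite kE.
- by move=> t /hc /Gm.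
- exact: line_C1_tail.
- move=> t /hc /F0; rewrite kE !upd_consS; exact.
Qed.

Local Notation sq f := (fun t => (f t ^+ 2)%:E).

Lemma measurable_sq d (T : measurableType d) (D : set T) (f : T -> R) :
  measurable_fun D f -> measurable_fun D (sq f).
Proof. by move=> mf; apply/measurable_EFinP; exact: measurable_funX. Qed.

Lemma integral_sq_ge0 d (T : measurableType d) (mu : {measure set T -> \bar R})
    (D : set T) (f : T -> R) : (0 <= \int[mu]_(t in D) (f t ^+ 2)%:E)%E.
Proof. by apply: integral_ge0 => x _; rewrite lee_fin sqr_ge0. Qed.

Lemma le_cbox n (a b c d : nat -> R) : (forall i, a i <= c i) -> (forall i, d i <= b i) ->
  cbox n c d `<=` cbox n a b.
Proof.
by move=> ac db t ht i; have /andP[? ?] := ht i; rewrite (le_trans (ac i))//= (le_trans _ (db i)).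
Qed.

(** The sub-box is enlarged in two stages: the tail coordinates by induction on n, on slices with
    the first coordinate in [c 0, d 0], then the first coordinate by [poincare_itv]. With constants
    C1 and C0 for the stages, C0 (C1 (B + E) + A) <= C0 (C1 + 1) (B + A + E). *)
Lemma cbox_poincare n (a b c d : nat -> R) :
  (forall i, a i <= c i) -> (forall i, c i < d i) -> (forall i, d i <= b i) ->
  exists2 C : R, 0 < C & forall (F : tup n -> R) (G : 'I_n -> tup n -> R),
    measurable_fun (cbox n a b) F ->
    (forall k, measurable_fun (cbox n a b) (G k)) ->
    line_C1 a b F G ->
    (\int[lebesgue_tuple n]_(t in cbox n a b) (F t ^+ 2)%:E <=
     C%:E * (\int[lebesgue_tuple n]_(t in cbox n c d) (F t ^+ 2)%:E +
             \sum_(k < n) \int[lebesgue_tuple n]_(t in cbox n a b) (G k t ^+ 2)%:E))%E.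
Proof.
elim: n a b c d => [|n IH] a b c d ac cd db.
  exists 1 => // F G mF mG FG; rewrite mul1e big_ord0 adde0.
  by rewrite (_ : cbox 0 a b = cbox 0 c d)//; apply/seteqP; split => t _ [].
have [C0 C00 H0] := poincare_itv (ac 0%N) (cd 0%N) (db 0%N).
have [C1 C10 H1] := IH (a \o succn) (b \o succn) (c \o succn) (d \o succn)
  (fun i => ac i.+1) (fun i => cd i.+1) (fun i => db i.+1).
exists (C0 * (C1 + 1)); first by rewrite mulr_gt0// addr_gt0.
move=> F G mF mG FG.
(* The intermediate box: still [c 0, d 0] in the first coordinate, already [a, b] in the others. *)
pose a1 i := if i is j.+1 then a j.+1 else c 0%N.
pose b1 i := if i is j.+1 then b j.+1 else d 0%N.
have subP : cbox n.+1 a1 b1 `<=` cbox n.+1 a b by apply: le_cbox => -[|i] //=.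
have subS : cbox n.+1 c d `<=` cbox n.+1 a1 b1 by apply: le_cbox => -[|i] //=.
have mP f : measurable_fun (cbox n.+1 a b) f -> measurable_fun (cbox n.+1 a1 b1) (f : _ -> R).
  by apply: measurable_funS => //; exact: measurable_cbox.
have mS f : measurable_fun (cbox n.+1 a b) f -> measurable_fun (cbox n.+1 c d) (f : _ -> R).
  by apply: measurable_funS; [exact: measurable_cbox|exact: subset_trans subP].
have sq0 (r : R) : (0 <= (r ^+ 2)%:E)%E by rewrite lee_fin sqr_ge0.
have stepP : (\int[lebesgue_tuple n.+1]_(t in cbox n.+1 a1 b1) (F t ^+ 2)%:E <=
    C1%:E * (\int[lebesgue_tuple n.+1]_(t in cbox n.+1 c d) (F t ^+ 2)%:E +
      \sum_(k < n) \int[lebesgue_tuple n.+1]_(t in cbox n.+1 a b) (G (lift ord0 k) t ^+ 2)%:E))%E.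
  have PQ k : (\int[lebesgue_tuple n.+1]_(t in cbox n.+1 a1 b1) (G (lift ord0 k) t ^+ 2)%:E <=
      \int[lebesgue_tuple n.+1]_(t in cbox n.+1 a b) (G (lift ord0 k) t ^+ 2)%:E)%E.
    by apply: ge0_le_integral_nomeas => // t _; rewrite lee_fin sqr_ge0.
  apply: (@le_trans _ _ (C1%:E * (\int[lebesgue_tuple n.+1]_(t in cbox n.+1 c d) (F t ^+ 2)%:E +
      \sum_(k < n) \int[lebesgue_tuple n.+1]_(t in cbox n.+1 a1 b1) (G (lift ord0 k) t ^+ 2)%:E)))%E; last first.
    by rewrite lee_wpmul2l ?lee_fin ?(ltW C10)// leeD2l// lee_sum.
  under eq_bigr do rewrite (integral_cbox_tonelli1 (measurable_sq (mP _ (mG _))) (fun t _ => sq0 _)).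
  rewrite (integral_cbox_tonelli1 (measurable_sq (mP _ mF)) (fun t _ => sq0 _)).
  rewrite (integral_cbox_tonelli1 (measurable_sq (mS _ mF)) (fun t _ => sq0 _)).
  have mGi k := measurable_cbox_tonelli1 (measurable_sq (mP _ (mG (lift ord0 k)))) (fun t _ => sq0 _).
  have mFi := measurable_cbox_tonelli1 (measurable_sq (mS _ mF)) (fun t _ => sq0 _).
  rewrite -ge0_integral_sum//; last by move=> k x _; exact: integral_sq_ge0.
  rewrite -ge0_integralD//; last 3 first.
  - by move=> x _; exact: integral_sq_ge0.
  - by move=> x _; apply: sume_ge0 => k _; exact: integral_sq_ge0.
  - exact: emeasurable_sum.
  rewrite -ge0_integralZl//; last 3 first.
  - by apply: emeasurable_funD => //; exact: emeasurable_sum.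
  - by move=> x _; rewrite adde_ge0 ?integral_sq_ge0// sume_ge0// => k _; exact: integral_sq_ge0.
  - by rewrite lee_fin ltW.
  apply: ge0_le_integral_nomeas => // x.
  - by move=> _; exact: integral_sq_ge0.
  - move=> _; rewrite mule_ge0 ?lee_fin ?(ltW C10)// adde_ge0 ?integral_sq_ge0//.
    by rewrite sume_ge0// => k _; exact: integral_sq_ge0.
  rewrite /= in_itv /= => /andP[cx xd].
  have hx : a 0%N <= x <= b 0%N by rewrite (le_trans _ cx)// (le_trans xd).
  apply: (H1 (fun t => F (tuple_cons (x, t))) (fun k t => G (lift ord0 k) (tuple_cons (x, t)))).
  - exact: measurable_cbox_tail.
  - by move=> k; exact: (measurable_cbox_tail (mG _) hx).
  - exact: line_C1_tail.
have stepQ : (\int[lebesgue_tuple n.+1]_(t in cbox n.+1 a b) (F t ^+ 2)%:E <=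
    C0%:E * (\int[lebesgue_tuple n.+1]_(t in cbox n.+1 a1 b1) (F t ^+ 2)%:E +
      \int[lebesgue_tuple n.+1]_(t in cbox n.+1 a b) (G ord0 t ^+ 2)%:E))%E.
  rewrite (integral_cbox_tonelli2 (measurable_sq mF) (fun t _ => sq0 _)).
  rewrite (integral_cbox_tonelli2 (measurable_sq (mP _ mF)) (fun t _ => sq0 _)).
  rewrite (integral_cbox_tonelli2 (measurable_sq (mG _)) (fun t _ => sq0 _)).
  have mGi := measurable_cbox_tonelli2 (measurable_sq (mG ord0)) (fun t _ => sq0 _).
  have mFi := measurable_cbox_tonelli2 (measurable_sq (mP _ mF)) (fun t _ => sq0 _).
  rewrite -ge0_integralD//; last 3 first.
  - exact: measurable_cbox.
  - by move=> x _; exact: integral_sq_ge0.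
  - by move=> x _; exact: integral_sq_ge0.
  rewrite -ge0_integralZl//; last 4 first.
  - exact: measurable_cbox.
  - exact: emeasurable_funD.
  - by move=> x _; rewrite adde_ge0 ?integral_sq_ge0.
  - by rewrite lee_fin ltW.
  apply: ge0_le_integral_nomeas => // t.
  - by move=> _; exact: integral_sq_ge0.
  - by move=> _; rewrite mule_ge0 ?lee_fin ?(ltW C00)// adde_ge0 ?integral_sq_ge0.
  move=> ht; apply: (H0 (fun s => F (tuple_cons (s, t))) (fun s => G ord0 (tuple_cons (s, t)))).
  - by move=> x /(line_C1_head FG ht)[].
  - by move=> x /(line_C1_head FG ht)[].
apply: (le_trans stepQ); rewrite big_ord_recl EFinM -muleA lee_wpmul2l ?lee_fin ?(ltW C00)//.
set A := (\int[_]_(t in _) (G ord0 t ^+ 2)%:E)%E.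
set B := (\int[_]_(t in cbox _ c d) _)%E.
set E := (\sum_(k < n) _)%E.
have A0 : (0 <= A)%E by exact: integral_sq_ge0.
have B0 : (0 <= B)%E by exact: integral_sq_ge0.
have E0 : (0 <= E)%E by apply: sume_ge0 => k _; exact: integral_sq_ge0.
apply: (le_trans (leeD stepP (lexx A))); rewrite -/B -/E EFinD.
rewrite ge0_muleDl ?lee_fin ?(ltW C10)// mul1e leeD//.
  by rewrite lee_wpmul2l ?lee_fin ?(ltW C10)// leeD2l// leeDr.
by rewrite addeCA leeDl// adde_ge0.
Qed.

End lines.

(** * Smooth functions and cutoffs *)

Section smooth_functions.
Context (R : realType) (n : nat).
Implicit Types (f g : 'rV[R]_n -> R) (U : set 'rV[R]_n).

(* The class is stable under partial derivatives, so all its members are smooth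
   by a plain induction on the list of derivatives. *)
Inductive smooth_alg U : ('rV[R]_n -> R) -> Prop :=
| smooth_alg_open f : smooth_open U f -> smooth_alg U f
| smooth_algD f g : smooth_alg U f -> smooth_alg U g -> smooth_alg U (f + g)
| smooth_algM f g : smooth_alg U f -> smooth_alg U g -> smooth_alg U (f * g)
| smooth_alg_ext f g : smooth_alg U f -> (forall x, U x -> f x = g x) -> smooth_alg U g.

Lemma smooth_open_partial U f k : smooth_open U f -> smooth_open U (partial k f).
Proof.
move=> Uf s x Ux; have := Uf (rcons s k) x Ux.
by rewrite (_ : partials (rcons s k) f = partials s (partial k f))// /partials foldr_rcons.
Qed.

Lemma smooth_alg_partial U f : open U -> smooth_alg U f ->
  (forall x, U x -> {for x, continuous f} /\ forall k : 'I_n, derivable f x (delta_mx 0 k)) /\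
  (forall k, smooth_alg U (partial k f)).
Proof.
move=> oU; elim=> [{}f Uf|{}f g _ [df sf] _ [dg sg]|{}f g fs [df sf] gs [dg sg]|{}f g _ [df sf] fg].
- split=> [x Ux|k]; first exact: (Uf [::] x Ux).
  by apply: smooth_alg_open; exact: smooth_open_partial.
- split=> [x Ux|k].
    have [cf dfx] := df x Ux; have [cg dgx] := dg x Ux.
    by split=> [|k]; [apply: continuousD|exact: derivableD].
  apply: smooth_alg_ext (smooth_algD (sf k) (sg k)) _ => x Ux.
  by rewrite /partial deriveD//; [exact: (df x Ux).2|exact: (dg x Ux).2].
- split=> [x Ux|k].
    have [cf dfx] := df x Ux; have [cg dgx] := dg x Ux.
    by split=> [|k]; [apply: continuousM|exact: derivableM].
  apply: smooth_alg_ext (smooth_algD (smooth_algM fs (sg k)) (smooth_algM gs (sf k))) _ => x Ux.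
  by rewrite /partial deriveM//; [exact: (df x Ux).2|exact: (dg x Ux).2].
- have nearfg x : U x -> \forall y \near x, f y = g y.
    by move=> Ux; apply: filterS (open_nbhs_nbhs (conj oU Ux)) => y; exact: fg.
  split=> [x Ux|k].
    have [cf dfx] := df x Ux; split=> [|k].
      by rewrite /prop_for /continuous_at -(fg x Ux); apply: cvg_trans cf; apply: near_eq_cvg; [exact: nbhs_filter|exact: nearfg].
    by apply: near_eq_derivable (dfx k); exact: nearfg.
  apply: smooth_alg_ext (sf k) _ => x Ux.
  by rewrite /partial; apply: near_eq_derive; exact: nearfg.
Qed.

Lemma smooth_algP U f : open U -> smooth_alg U f -> smooth_open U f.
Proof.
move=> oU Uf s x Ux.
suff /(smooth_alg_partial oU)[/(_ x Ux) //] : smooth_alg U (partials s f).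
by elim: s => //= k s IH; apply: (smooth_alg_partial oU IH).2.
Qed.

Lemma smooth_openM U f g : open U -> smooth_open U f -> smooth_open U g ->
  smooth_open U (f * g).
Proof.
by move=> oU fU gU; apply: smooth_algP => //; apply: smooth_algM; exact: smooth_alg_open.
Qed.

Lemma smooth_open_ext U f g : open U -> (forall x, U x -> f x = g x) ->
  smooth_open U f -> smooth_open U g.
Proof.
move=> oU fg fU; apply: smooth_algP => //.
by apply: smooth_alg_ext fg; exact: smooth_alg_open.
Qed.

Lemma smooth_open_cst U (c : R) : smooth_open U (cst c).
Proof.
move=> s x Ux; suff [c' ->] : exists c', partials s (cst c) = cst c'.
  by split=> [|k]; [exact: cst_continuous|exact: derivable_cst].
elim: s => [|k s [c' IH]]; first by exists c.
by exists 0; rewrite /= IH; apply/funext => y; rewrite /partial derive_cst.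
Qed.

Lemma smooth_openW U V f : V `<=` U -> smooth_open U f -> smooth_open V f.
Proof. by move=> VU Uf s x /VU; exact: Uf. Qed.

Lemma smooth_open_local U f :
  (forall x, U x -> exists V g, [/\ open V, V x, smooth_open V g & forall y, V y -> g y = f y]) ->
  smooth_open U f.
Proof.
move=> H s x Ux; have [V [g [oV Vx Vg fg]]] := H x Ux.
exact: (smooth_open_ext oV fg Vg).
Qed.

(** Gives access to the one-variable chain rule, which is how all later directional derivatives of
    compositions are computed. *)
Lemma is_derive_line f x v (d : R) :
  is_derive x v f d <-> is_derive (0 : R) 1 (fun h : R => f (h *: v + x)) d.
Proof.
have E : 'D_1 (fun h : R => f (h *: v + x)) 0 = 'D_v f x.
  rewrite /derive; set g1 := fun h => h^-1 *: _; set g2 := fun h => h^-1 *: _.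
  suff -> : g1 = g2 by []; apply/funext => h; rewrite /g1 /g2 /=.
  by rewrite scale0r add0r addr0 [_ *: 1]mulr1.
split=> -[df dE]; split; rewrite -?dE; [exact: (derivable1P f x v).1|exact: E|exact: (derivable1P f x v).2|exact: esym E].
Qed.

Lemma is_derive_coord (phi : R -> R) (s c d : R) (x : 'rV[R]_n) (k j : 'I_n) :
  is_derive (s * x 0 k + c) 1 phi d ->
  is_derive x (delta_mx 0 j) (fun y => phi (s * y 0 k + c)) ((k == j)%:R * s * d).
Proof.
move=> dphi; apply/is_derive_line.
have -> : (fun h : R => phi (s * (h *: delta_mx 0 j + x) 0 k + c)) =
   phi \o (fun h => (s * (k == j)%:R) * h + (s * x 0 k + c)).
  by apply/funext => h /=; congr phi; rewrite !mxE eqxx /=; ring.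
have dl : is_derive (0 : R) 1 (fun h : R => (s * (k == j)%:R) * h + (s * x 0 k + c)) (s * (k == j)%:R).
  by apply: is_derive_eq; rewrite /GRing.scale /= mulr1 addr0.
have dphi' : is_derive ((fun h : R => s * (k == j)%:R * h + (s * x 0 k + c)) 0) 1 phi d.
  by rewrite mulr0 add0r.
by have := @is_derive1_comp R phi (fun h => s * (k == j)%:R * h + (s * x 0 k + c)) 0 _ _ dphi' dl; rewrite [d * _]mulrC [s * _%:R]mulrC.
Qed.

End smooth_functions.

(** * Flat functions and bump functions *)

Section bump.
Context (R : realType).
Implicit Types P : {poly R}.

(* The derivative of [flat P] is again of this form, see [is_derive_flat]. *)
Definition flat P (x : R) : R := if 0 < x then P.[x^-1] * expR (- x^-1) else 0.

Lemma horner_expRN_bounded P : exists C : R, forall y, 0 <= y -> `|P.[y] * expR (- y)| <= C.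
Proof.
(* The extra factor y^m closes the induction on P: passing from P to P X + c raises m by one. *)
suff H (m : nat) : exists C : R, forall y, 0 <= y -> `|y ^+ m * P.[y] * expR (- y)| <= C.
  by have [C HC] := H 0%N; exists C => y /HC; rewrite expr0 mul1r.
elim/poly_ind: P m => [|P c IH] m.
  by exists 0 => y _; rewrite horner0 mulr0 mul0r normr0.
have [C HC] := IH m.+1; exists (C + `|c| * m`!%:R) => y y0.
rewrite hornerMXaddC (_ : _ * _ = y ^+ m.+1 * P.[y] * expR (- y) + c * (y ^+ m * expR (- y))); last first.
  by rewrite exprS; ring.
rewrite (le_trans (ler_normD _ _))// lerD ?HC// normrM ler_wpM2l//.
rewrite ger0_norm ?mulr_ge0 ?exprn_ge0 ?expR_ge0// expRN ler_pdivrMr ?expR_gt0//.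
case: m {IH HC} => [|m]; first by rewrite fact0 mul1r expr0 (le_trans _ (expR_ge1Dx y))// lerDl.
rewrite mulrC -ler_pdivrMr ?ltr0n ?fact_gt0//.
by apply: le_trans (expR_ge1Dxn m y0); rewrite lerDr.
Qed.

(** Boundedness of ['X^2 * P] times the exponential, read at 1/x. Quadratic smallness at 0 is what
    makes the derivative there exist and vanish. *)
Lemma flat_le_sqr P : exists C : R, forall x, `|flat P x| <= C * x ^+ 2.
Proof.
have [C HC] := horner_expRN_bounded ('X^2 * P); exists C => x; rewrite /flat.
have C0 : 0 <= C by apply: le_trans (HC 0 (lexx _)).
case: ifPn => x0; last by rewrite normr0 mulr_ge0 ?sqr_ge0.
have := HC x^-1; rewrite invr_ge0 ltW// hornerM hornerXn => /(_ isT) H.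
rewrite (_ : P.[_] * _ = x ^+ 2 * (x^-1 ^+ 2 * P.[x^-1] * expR (- x^-1))); last first.
  by rewrite -[x^-1 ^+ 2 * _ * _]mulrA [RHS]mulrA -exprMn divff ?gt_eqF// expr1n mul1r.
by rewrite normrM ger0_norm ?sqr_ge0// mulrC ler_wpM2r ?sqr_ge0.
Qed.

Lemma is_derive0_le_sqr (f : R -> R) (C : R) :
  (forall x, `|f x| <= C * x ^+ 2) -> is_derive (0 : R) 1 f 0.
Proof.
move=> fC.
have f0 : f 0 = 0.
  by apply/eqP; rewrite -normr_le0 (le_trans (fC 0))// expr0n mulr0.
have C0 : 0 <= C by have := fC 1; rewrite expr1n mulr1; exact: le_trans.
have lim0 : h^-1 *: (f (h *: 1 + 0) - f 0) @[h --> (0 : R)^'] --> (0 : R).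
  apply/cvgr0Pnorm_le => e e0; near=> h.
  have h0 : h != 0 by near: h; exact: nbhs_dnbhs_neq.
  rewrite f0 subr0 addr0 [_ *: 1]mulr1 normrM normfV ler_pdivrMl ?normr_gt0//.
  rewrite (le_trans (fC h))// -(ger0_norm (sqr_ge0 h)) normrX expr2 mulrA [leRHS]mulrC ler_wpM2r//.
  have : `|h| <= e / (C + 1).
    by near: h; apply: dnbhs0_le; rewrite divr_gt0// ltr_wpDl.
  rewrite ler_pdivlMr ?ltr_wpDl// => /(le_trans _); apply.
  by rewrite mulrC ler_wpM2l// lerDl.
apply: DeriveDef; first by apply/cvg_ex; exists 0.
exact: cvg_lim lim0.
Unshelve. all: by end_near.
Qed.

(** For x > 0 the exponential contributes P, the polynomial contributes -P', and the common factor
    x^-2 from the derivative of 1/x is ['X^2] at 1/x. At 0 the bound [flat_le_sqr] replaces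
    computation. *)
Lemma is_derive_flat P (x : R) : is_derive x 1 (flat P) (flat ('X^2 * (P - P^`())) x).
Proof.
have [x0|x0|->] := ltgtP x 0.
- rewrite {2}/flat ltNge ltW//=.
  have nx : \forall y \near x, 0 = flat P y.
    by near=> y; rewrite /flat ltNge ltW//; near: y; exact: lt_nbhsl.
  by apply: near_eq_is_derive nx _; exact: is_derive_cst.
- rewrite {2}/flat x0.
  have nx : \forall y \near x, P.[y^-1] * expR (- y^-1) = flat P y.
    by near=> y; rewrite /flat ifT//; near: y; exact: lt_nbhsr.
  apply: near_eq_is_derive nx _.
  have dV : is_derive x 1 (fun y : R => y^-1) (- x ^- 2).
    have := @is_deriveV R id x 1 1; rewrite /GRing.scale /= mulr1.
    by apply; rewrite ?gt_eqF.
  have dP : is_derive x^-1 1 (fun z => P.[z] * expR (- z))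
      ((P^`() - P).[x^-1] * expR (- x^-1)).
    have dE : is_derive x^-1 1 (fun z : R => expR (- z)) (- expR (- x^-1)).
      rewrite -mulrN1.
      by apply: (@is_derive1_comp _ expR -%R).
    apply: (is_derive_eq (is_deriveM (is_derive_poly P x^-1) dE)).
    by rewrite /GRing.scale /= hornerD hornerN; ring.
  apply: (is_derive_eq (is_derive1_comp dP dV)).
  rewrite hornerM hornerXn !hornerD !hornerN exprVn; ring.
- rewrite {2}/flat ltxx; have [C HC] := flat_le_sqr P.
  exact: is_derive0_le_sqr HC.
Unshelve. all: by end_near.
Qed.

Lemma flat1E (x : R) : flat 1 x = if 0 < x then expR (- x^-1) else 0.
Proof. by rewrite /flat hornerC mul1r. Qed.

Lemma flat1_ge0 (x : R) : 0 <= flat 1 x.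
Proof. by rewrite flat1E; case: ifP => // _; exact: expR_ge0. Qed.

Lemma flat1_le1 (x : R) : flat 1 x <= 1.
Proof.
rewrite flat1E; case: ifP => // x0.
by rewrite -(@expR0 R) ler_expR oppr_le0 invr_ge0 ltW.
Qed.

Lemma flat1_gt0 (x : R) : 0 < x -> 0 < flat 1 x.
Proof. by move=> x0; rewrite flat1E x0 expR_gt0. Qed.

Lemma flat1_eq0 (x : R) : x <= 0 -> flat 1 x = 0.
Proof. by move=> x0; rewrite flat1E ltNge x0. Qed.

Lemma le_flat1 (x y : R) : x <= y -> flat 1 x <= flat 1 y.
Proof.
have [x0 _|x0 xy] := leP x 0; first by rewrite (flat1_eq0 x0) flat1_ge0.
have y0 := lt_le_trans x0 xy.
by rewrite !flat1E x0 y0 ler_expR lerN2 lef_pV2.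
Qed.

Lemma flat_continuous P : continuous (flat P).
Proof.
move=> x; apply/differentiable_continuous/derivable1_diffP.
by have [] := is_derive_flat P x.
Qed.

(** Functions of the form m * [flat Q] of the affine argument are stable under partial derivatives;
    a direction other than k merely makes m zero. *)
Lemma smooth_open_flat n P (s c : R) (k : 'I_n) :
  smooth_open setT (fun y : 'rV[R]_n => flat P (s * y 0 k + c)).
Proof.
have dflat (m : R) Q (y : 'rV[R]_n) j :
    is_derive y (delta_mx 0 j) (cst m * (fun y : 'rV[R]_n => flat Q (s * y 0 k + c)))
      (m * ((k == j)%:R * s) * flat ('X^2 * (Q - Q^`())) (s * y 0 k + c)).
  have D := is_derive_coord j (is_derive_flat Q (s * y 0 k + c)).
  apply: (is_derive_eq (is_deriveM (is_derive_cst m y (delta_mx 0 j)) D)).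
  by rewrite scaler0 addr0 -[RHS]mulrA.
move=> l x _.
suff [m [Q ->]] : exists m Q, partials l (fun y : 'rV[R]_n => flat P (s * y 0 k + c)) =
    cst m * (fun y : 'rV[R]_n => flat Q (s * y 0 k + c)).
  split=> [|j]; last by have [] := dflat m Q x j.
  apply: continuousM; first exact: cst_continuous.
  apply: continuous_comp; last exact: flat_continuous.
  apply: continuousD; last exact: cst_continuous.
  apply: continuousM; first exact: cst_continuous.
  exact: matrix_normedtype.coord_continuous.
elim: l => [|j l [m [Q IH]]].
  by exists 1, P; apply/funext => y /=; rewrite [RHS]mul1r.
exists (m * ((k == j)%:R * s)), ('X^2 * (Q - Q^`())).
by rewrite /= IH; apply/funext => y; rewrite /partial; have [_ ->] := dflat m Q y j.
Qed.

Lemma smooth_open_prod n (U : set 'rV[R]_n) (I : Type) (r : seq I) (F : I -> 'rV[R]_n -> R) :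
  open U -> (forall i, smooth_open U (F i)) ->
  smooth_open U (fun y => \prod_(i <- r) F i y).
Proof.
move=> oU FU; elim: r => [|i r IH].
  apply: (@smooth_open_ext _ _ U (cst 1)) => // [x _|]; first by rewrite big_nil.
  exact: smooth_open_cst.
apply: (@smooth_open_ext _ _ U (F i * (fun y => \prod_(i <- r) F i y))) => // [x _|].
  by rewrite big_cons.
exact: smooth_openM.
Qed.

(** The product over k of [flat 1] at x_k - a_k and at b_k - x_k. Each factor is monotone, so the
    inner box gives the lower bound e. A bound e in place of the value 1 avoids building a plateau;
    1/e goes into the constant of [local_poincare]. *)
Lemma bump_box n (a b c d : nat -> R) :
  (forall i, a i < c i) -> (forall i, d i < b i) ->
  exists (chi : 'rV[R]_n -> R) (e : R),
    [/\ smooth_open setT chi, forall x, 0 <= chi x <= 1,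
        forall (x : 'rV[R]_n) (k : 'I_n), ~ (a k < x 0 k < b k) -> chi x = 0, 0 < e &
        forall x : 'rV[R]_n, (forall k : 'I_n, c k <= x 0 k <= d k) -> e <= chi x].
Proof.
move=> ac db.
pose chi (x : 'rV[R]_n) := \prod_(k < n) (flat 1 (1 * x 0 k - a k) * flat 1 ((-1) * x 0 k + b k)).
exists chi, (\prod_(k < n) (flat 1 (c k - a k) * flat 1 (b k - d k))); split.
- apply: smooth_open_prod => [|k]; first exact: openT.
  by apply: smooth_openM; [exact: openT|exact: smooth_open_flat|exact: smooth_open_flat].
- move=> x; rewrite prodr_ge0/=; last by move=> k _; rewrite mulr_ge0 ?flat1_ge0.
  by apply: prodr_ile1 => k _; rewrite mulr_ge0 ?flat1_ge0// mulr_ile1 ?flat1_ge0 ?flat1_le1.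
- move=> x k /negP; rewrite negb_and -!leNgt => xk; apply/eqP; rewrite prodf_seq_eq0.
  apply/hasP; exists k; first by rewrite mem_index_enum.
  rewrite /= mulf_eq0; apply/orP; case/orP: xk => xk; [left|right]; apply/eqP/flat1_eq0; lra.
- by apply: prodr_gt0 => k _; rewrite mulr_gt0// flat1_gt0// subr_gt0.
- move=> x xcd; apply: ler_prod => k _; rewrite mulr_ge0 ?flat1_ge0//=.
  by have /andP[? ?] := xcd k; apply: ler_pM; rewrite ?flat1_ge0//; apply: le_flat1; lra.
Qed.

End bump.

(** * Continuously differentiable functions on row vectors *)

Section rows.
Context (R : realType).

Lemma rV_norm_coord n (x : 'rV[R]_n) k : `|x 0 k| <= `|x|.
Proof.
rewrite {2}/Num.norm /= mx_normrE.
exact: (le_bigmax _ (fun i : 'I_1 * 'I_n => `|x i.1 i.2|) (0, k)).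
Qed.

Lemma rV_norm_le n (x : 'rV[R]_n) e : 0 <= e -> (forall k, `|x 0 k| <= e) -> `|x| <= e.
Proof.
move=> e0 xe; rewrite /Num.norm /= mx_normrE.
by apply: bigmax_le => // -[i k] _ /=; rewrite ord1.
Qed.

Lemma nbhs_rVP n (x : 'rV[R]_n) (P : set 'rV[R]_n) : nbhs x P <->
  exists2 e : R, 0 < e & forall y : 'rV[R]_n, (forall k, `|y 0 k - x 0 k| < e) -> P y.
Proof.
split=> [/nbhs_ballP[e /= e0 bO]|[e e0 He]].
  exists e => // y xy; apply: bO; split => // i j.
  by rewrite /ball/= distrC; have := xy j; rewrite !ord1.
apply/nbhs_ballP; exists e => //= y [_ xy]; apply: He => k.
by rewrite distrC; exact: (xy 0 k).
Qed.

(** Topology and derivatives live on row vectors, the measure on tuples; this is the counterpart of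
    [cbox] on the row side. *)
Definition rbox n (a b : nat -> R) : set 'rV[R]_n :=
  [set x | forall k : 'I_n, a k <= x 0 k <= b k].

Lemma rbox_row n a b (t : n.-tuple R) : rbox a b (tuple_row t) <-> cbox n a b t.
Proof. by split=> h k; have := h k; rewrite tuple_rowE. Qed.

Lemma compact_rbox n a b : compact (@rbox n a b).
Proof.
rewrite (_ : rbox a b = [set v : 'rV[R]_n | forall k : 'I_n, `[a k, b k]%classic (v ord0 k)]).
  by apply: (@rV_compact R n (fun k : 'I_n => `[a k, b k]%classic)) => k; exact: segment_compact.
by apply/seteqP; split=> x h k; have := h k; rewrite /= in_itv.
Qed.

Lemma rbox_bounded n a b (U : set 'rV[R]_n) (f : 'rV[R]_n -> R) :
  rbox a b `<=` U -> (forall x, U x -> {for x, continuous f}) ->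
  exists2 m : R, 0 <= m & forall x, rbox a b x -> `|f x| <= m.
Proof.
move=> abU cf.
have [ab0|ab0] := pselect (@rbox n a b !=set0); last first.
  by exists 0 => // x abx; case: ab0; exists x.
have cnf : {within @rbox n a b, continuous (fun x => `|f x|)}.
  apply: continuous_in_subspaceT => x /set_mem /abU /cf cfx.
  exact: (continuous_comp cfx (@norm_continuous _ _ _)).
have [c _ Hc] := EVT_max_rV ab0 (@compact_rbox n a b) cnf.
by exists `|f c| => // x abx; apply: Hc; rewrite inE.
Qed.

Definition C1_on n (U : set 'rV[R]_n) (f : 'rV[R]_n -> R) := forall x, U x ->
  [/\ {for x, continuous f}, forall k : 'I_n, derivable f x (delta_mx 0 k) &
      forall k, {for x, continuous (partial k f)}].

Lemma smooth_open_C1 n (U : set 'rV[R]_n) f : smooth_open U f -> C1_on U f.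
Proof.
move=> Uf x Ux; have [cf df] := Uf [::] x Ux; split=> // k.
by have [] := Uf [:: k] x Ux.
Qed.

Lemma tuple_row_upd n (t : n.-tuple R) k (s : R) :
  tuple_row (upd t k s) = (s - tnth t k) *: delta_mx 0 k + tuple_row t.
Proof.
apply/rowP => j; rewrite !mxE tnth_mktuple eqxx /=.
by case: eqVneq => [->|]; rewrite ?mulr1 ?mulr0 ?add0r// subrK.
Qed.

Lemma C1_line_C1 n a b (U : set 'rV[R]_n) f :
  C1_on U f -> (forall t : n.-tuple R, cbox n a b t -> U (tuple_row t)) ->
  line_C1 a b (fun t => f (tuple_row t)) (fun k t => partial k f (tuple_row t)).
Proof.
move=> f1 abU t k /abU /f1[cf df cpf].
split.
  have -> : (fun s : R => f (tuple_row (upd t k s))) =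
      (fun h => f (h *: delta_mx 0 k + tuple_row t)) \o (fun s => s - (tnth t k : R)).
    by apply/funext => s /=; rewrite tuple_row_upd.
  rewrite -[partial _ _ _]mulr1.
  have dl : is_derive (tnth t k : R) 1 (fun s : R => s - (tnth t k : R)) 1.
    by apply: is_derive_eq; rewrite subr0.
  apply: is_derive1_comp dl; rewrite subrr.
  by apply/is_derive_line; apply: DeriveDef (df k) _.
have -> : (fun s : R => partial k f (tuple_row (upd t k s))) =
    partial k f \o (fun s => (s - (tnth t k : R)) *: delta_mx 0 k + tuple_row t).
  by apply/funext => s /=; rewrite tuple_row_upd.
apply: continuous_comp.
  apply: continuousD; last exact: cst_continuous.
  apply: continuousZr_tmp.
  by apply: continuousB => //; exact: cst_continuous.
by rewrite subrr scale0r add0r; exact: cpf.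
Qed.

(* [f y - f x] telescopes along the path from x to y moving one coordinate at a
   time, each step being controlled by the mean value theorem. *)
Lemma C1_frechet n (U : set 'rV[R]_n) f x : open U -> C1_on U f -> U x ->
  forall e : R, 0 < e -> \forall y \near x,
    `|f y - f x - \sum_k (y - x) 0 k * partial k f x| <= e * `|y - x|.
Proof.
move=> oU f1 Ux e e0.
(* There are n steps, each with error e' times the norm of y - x; n + 1 keeps the divisor nonzero
   when n = 0. *)
pose e' := e / (n.+1)%:R.
have e'0 : 0 < e' by rewrite divr_gt0.
have : \forall y \near x, U y /\ forall k, `|partial k f x - partial k f y| <= e'.
  have H : \forall y \near x, forall k, `|partial k f x - partial k f y| <= e'.
    apply: (@filter_forall _ _ (fun k (y : 'rV[R]_n) => `|partial k f x - partial k f y| <= e') _ (nbhs_filter x)) => k; have [_ _ /(_ k) cf] := f1 x Ux.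
    by move/cvgrPdist_le : cf; exact.
  exact: filterI (open_nbhs_nbhs (conj oU Ux)) H.
move=> /nbhs_rVP[r r0 Hr]; apply/nbhs_rVP; exists r => // y yx.
pose z (j : nat) : 'rV[R]_n := \row_k (if (k < j)%N then y 0 k else x 0 k).
have z0 : z 0%N = x by apply/rowP => k; rewrite mxE.
have zn : z n = y by apply/rowP => k; rewrite mxE ltn_ord.
have zS (j : 'I_n) : z j.+1 = (y - x) 0 j *: delta_mx 0 j + z j.
  apply/rowP => k; rewrite !mxE eqxx /= ltnS leq_eqVlt.
  case: (eqVneq k j) => [->|kj]; first by rewrite eqxx ltnn /= mulr1 subrK.
  by rewrite (_ : (k == j :> nat) = false) ?mulr0 ?add0r//; exact/negbTE.
have step (j : 'I_n) : `|f (z j.+1) - f (z j) - (y - x) 0 j * partial j f x| <= e' * `|y - x|.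
  pose w (s : R) := (s * (y - x) 0 j) *: delta_mx 0 j + z j.
  have wr (s : R) : 0 <= s <= 1 -> U (w s) /\ forall k, `|partial k f x - partial k f (w s)| <= e'.
    move=> /andP[s0 s1]; apply: Hr => k; rewrite !mxE eqxx /=.
    case: (eqVneq k j) => [->|kj].
      rewrite ltnn mulr1 addrK normrM ger0_norm//.
      by rewrite (le_lt_trans _ (yx j))// ler_piMl.
    by rewrite mulr0 add0r; case: ifP => _; rewrite ?yx// subrr normr0.
  have dw (s : R) : 0 <= s <= 1 -> is_derive s 1 (f \o w) ((y - x) 0 j * partial j f (w s)).
    move=> /wr[/f1[_ /(_ j) df _] _].
    have -> : f \o w = (fun h => f (h *: delta_mx 0 j + w s)) \o (fun s' => (s' - s) * (y - x) 0 j).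
      by apply/funext => s' /=; rewrite /w addrA -scalerDl -mulrDl subrK.
    have dl : is_derive s 1 (fun s' : R => (s' - s) * (y - x) 0 j) ((y - x) 0 j).
      by apply: is_derive_eq; rewrite /GRing.scale /= ?subrr ?mulr0 ?add0r ?subr0 ?mulr1 ?addr0.
    rewrite mulrC; apply: is_derive1_comp dl; rewrite subrr mul0r.
    by apply/is_derive_line; apply: DeriveDef df _.
  have [| | |s s01] := @MVT_segment R (f \o w) (fun s => (y - x) 0 j * partial j f (w s)) 0 1.
  - exact: ler01.
  - by move=> s; rewrite in_itv /= => /andP[s0 s1]; apply: dw; rewrite !ltW.
  - apply: continuous_in_subspaceT => s; rewrite inE /= in_itv /= => /dw [ds _].
    exact/differentiable_continuous/derivable1_diffP.
  - rewrite subr0 mulr1 /= {1}/w mul1r -zS {1}/w mul0r scale0r add0r => ->.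
    rewrite -mulrBr normrM mulrC ler_pM//; last exact: rV_norm_coord.
    rewrite distrC; apply: (wr s _).2.
    by move: s01; rewrite in_itv.
have -> : f y - f x = \sum_(j < n) (f (z j.+1) - f (z j)).
  by rewrite -(big_mkord xpredT (fun j => f (z j.+1) - f (z j))) telescope_sumr// z0 zn.
rewrite -sumrB (le_trans (ler_norm_sum _ _ _))//.
rewrite (le_trans (ler_sum _ (fun j _ => step j)))//.
rewrite sumr_const card_ord -mulr_natl mulrA ler_wpM2r//.
rewrite /e' mulrCA ler_piMr ?(ltW e0)// ler_pdivrMr ?ltr0n// mul1r ler_nat.
exact: leqnSn.
Qed.

End rows.

(** * Positive definite matrices *)

Section positive_definite.
Context (R : realType) (n : nat).
Implicit Types (A : 'M[R]_n) (v w : 'rV[R]_n).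

Lemma cvg_det (T : Type) (F : set_system T) (FF : Filter F) (A : T -> 'M[R]_n) (L : 'M[R]_n) :
  (forall i j, A x i j @[x --> F] --> L i j) -> \det (A x) @[x --> F] --> \det L.
Proof.
move=> AL; apply: cvg_big => [|s _]; first exact: add_continuous.
apply: cvgM; first exact: cvg_cst.
by apply: cvg_big => [|i _]; [exact: mul_continuous|exact: AL].
Qed.

Definition posdef A := A^T = A /\ forall v, v != 0 -> 0 < (v *m A *m v^T) 0 0.

Lemma posdef_unit A : posdef A -> A \in unitmx.
Proof.
move=> [_ A0]; rewrite -row_free_unit; apply: inj_row_free => v vA.
apply/eqP; apply: contraT => /A0; by rewrite vA mul0mx mxE ltxx.
Qed.

Lemma posdef_ge0 A v : posdef A -> 0 <= (v *m A *m v^T) 0 0.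
Proof.
move=> [_ A0]; have [->|/A0/ltW//] := eqVneq v 0.
by rewrite !mul0mx mxE.
Qed.

(** The vector v A^-1 is metrically dual to the covector v and has the same norm, so facts about A
    transfer to its inverse. *)
Lemma posdef_inv A v : posdef A ->
  v *m invmx A *m v^T = (v *m invmx A) *m A *m (v *m invmx A)^T :> 'M[R]_1.
Proof.
move=> pA; have uA := posdef_unit pA.
by rewrite mulmxKV// trmx_mul trmx_inv pA.1 mulmxA.
Qed.

Lemma posdef_inv_ge0 A v : posdef A -> 0 <= (v *m invmx A *m v^T) 0 0.
Proof. by move=> pA; rewrite posdef_inv//; exact: posdef_ge0. Qed.

Lemma posdef_cauchy_schwarz A v w : posdef A ->
  (v *m A *m w^T) 0 0 ^+ 2 <= (v *m A *m v^T) 0 0 * (w *m A *m w^T) 0 0.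
Proof.
move=> pA; have [->|w0] := eqVneq w 0.
  by rewrite trmx0 !mulmx0 (_ : (0 : 'M[R]_1) 0 0 = 0) ?mxE// expr0n mulr0.
have ww : 0 < (w *m A *m w^T) 0 0 by exact: pA.2.
have sym : (w *m A *m v^T) 0 0 = (v *m A *m w^T) 0 0.
  transitivity ((w *m A *m v^T)^T 0 0); first by rewrite [RHS]mxE.
  by rewrite !trmx_mul trmxK pA.1 mulmxA.
set q := (v *m A *m w^T) 0 0 in sym *; set r := (w *m A *m w^T) 0 0 in ww *.
(* The form at r v - q w equals r (p r - q^2), with p the form at v. *)
have := posdef_ge0 (r *: v - q *: w) pA.
have entB (M N : 'M[R]_1) : (M - N) 0 0 = M 0 0 - N 0 0 by rewrite !mxE.
have entZ (x : R) (M : 'M[R]_1) : (x *: M) 0 0 = x * M 0 0 by rewrite mxE.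
have -> : (r *: v - q *: w)^T = r *: v^T - q *: w^T by rewrite linearB /= !linearZ.
rewrite mulmxBr !mulmxBl -!scalemxAl -!scalemxAr !(entB, entZ).
rewrite sym -/q -/r.
set p := (v *m A *m v^T) 0 0 => H.
have {H} : 0 <= r * (p * r - q ^+ 2) by apply: le_trans H _; rewrite le_eqVlt; apply/orP; left; apply/eqP; ring.
by rewrite pmulr_rge0// subr_ge0.
Qed.

(** Cauchy-Schwarz for the dual vector v A^-1 and the k-th basis vector: their pairing under A is
    the k-th component of v. This bounds components of a covector by its norm. *)
Lemma posdef_coord_le A v k : posdef A ->
  v 0 k ^+ 2 <= A k k * (v *m invmx A *m v^T) 0 0.
Proof.
move=> pA; have := posdef_cauchy_schwarz (v *m invmx A) (delta_mx 0 k) pA.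
rewrite -posdef_inv// mulrC mulmxKV ?posdef_unit// trmx_delta -rowE -!colE !mxE.
exact.
Qed.

(* The determinant does not vanish on the segment from 1 to A. *)
Lemma posdef_det_gt0 A : posdef A -> 0 < \det A.
Proof.
move=> pA; pose B (t : R) := (1 - t) *: 1%:M + t *: A.
have pB t : 0 <= t <= 1 -> posdef (B t).
  move=> /andP[t0 t1]; split=> [|v v0].
    by rewrite linearD !linearZ /= trmx1 pA.1.
  have vv : 0 < (v *m 1%:M *m v^T) 0 0.
    rewrite mulmx1 mxE; have /rV0Pn[k vk] := v0.
    rewrite (bigD1 k)//= ltr_wpDr//.
      by apply: sumr_ge0 => j _; rewrite !mxE -expr2 sqr_ge0.
    by rewrite !mxE -expr2 lt_neqAle eq_sym sqrf_eq0 vk sqr_ge0.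
  have vA := pA.2 v v0.
  rewrite mulmxDr mulmxDl -!scalemxAr -!scalemxAl !mxE.
  move: vv vA; rewrite !mxE; set x := (\sum_j _); set y := (\sum_j _) => vv vA.
  have [->|t0'] := eqVneq t 0; first by rewrite subr0 mul1r mul0r addr0.
  by rewrite ltr_wpDl ?mulr_ge0 ?subr_ge0 ?(ltW vv)// mulr_gt0// lt_neqAle eq_sym t0'.
have cB : continuous (fun t => \det (B t)).
  move=> t; apply: cvg_det => i j.
  rewrite [X in X @ _](_ : _ = fun t => (1 - t) * (1%:M : 'M[R]_n) i j + t * A i j); last first.
    by apply/funext => s; rewrite !mxE.
  rewrite (_ : B t i j = (1 - t) * (1%:M : 'M[R]_n) i j + t * A i j); last by rewrite !mxE.
  apply: cvgD; apply: cvgM; [|exact: cvg_cst| |exact: cvg_cst] => //.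
  by apply: cvgB => //; exact: cvg_cst.
rewrite ltNge; apply/negP => A0.
have [|||t] := @IVT R (fun t => \det (B t)) 0 1 0.
- exact: ler01.
- by apply: continuous_subspaceT.
- rewrite /B subr0 scale1r scale0r addr0 subrr scale0r add0r scale1r det1.
  by rewrite ge_min A0 orbT le_max ler01.
- rewrite in_itv /= => /pB /posdef_unit; rewrite unitmxE unitfE => /negP H.
  by move/eqP.
Qed.

(** Independence of the chart for the norm of a covector. Invertibility of J comes from that of
    A. *)
Lemma conorm_transition (A B J : 'M[R]_n) v w : posdef A -> posdef B ->
  A = J *m B *m J^T -> v = w *m J^T ->
  v *m invmx A *m v^T = w *m invmx B *m w^T.
Proof.
move=> pA pB AJ ->.
have uA := posdef_unit pA; have uB := posdef_unit pB.
have uJ : J \in unitmx.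
  by move: uA; rewrite AJ !unitmxE !det_mulmx !unitfE !mulf_eq0 !negb_or => /andP[/andP[]].
have uJT : J^T \in unitmx by rewrite unitmx_tr.
suff -> : w *m J^T *m invmx A = w *m invmx B *m invmx J.
  by rewrite trmx_mul trmxK -!mulmxA (mulmxA (invmx J)) mulVmx// mul1mx.
by apply: (canLR (mulmxK uA)); rewrite AJ !mulmxA mulmxKV// mulmxKV.
Qed.

End positive_definite.

(** * Charts *)

(** Smoothness provides local extensions with partial derivatives, whereas [is_jacobian] asks for a
    first-order expansion; [C1_frechet] applied to each component links the two. *)
Lemma smooth_on_jacobian (R : realType) n m (D : set 'rV[R]_n)
    (f : 'rV[R]_n -> 'rV[R]_m) x :
  (forall k, smooth_on D (fun y => f y 0 k)) -> D x ->
  exists J : 'M[R]_(n, m), is_jacobian D f x J.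
Proof.
move=> fD Dx.
have /choice[UF HUF] k : exists UF : set 'rV[R]_n * ('rV[R]_n -> R),
  [/\ open UF.1, UF.1 x, smooth_open UF.1 UF.2 & forall y, UF.1 y -> D y -> UF.2 y = f y 0 k].
  by have [U [F HUF]] := fD k x Dx; exists (U, F).
exists (\matrix_(l, k) partial l (UF k).2 x) => e e0.
have : \forall y \near x, forall k, D y ->
    `|f y 0 k - f x 0 k - \sum_l (y - x) 0 l * partial l (UF k).2 x| <= e * `|y - x|.
  apply: (@filter_forall _ _ (fun k (y : 'rV[R]_n) => D y -> `|f y 0 k - f x 0 k -
    \sum_l (y - x) 0 l * partial l (UF k).2 x| <= e * `|y - x|) _ (nbhs_filter x)) => k.
  have [oU Ux sF Ff] := HUF k.
  have H1 := C1_frechet oU (smooth_open_C1 sF) Ux e0.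
  apply: filterS2 (open_nbhs_nbhs (conj oU Ux)) H1 => y Uy.
  by move=> + Dy; rewrite (Ff _ Uy Dy) (Ff _ Ux Dx).
apply: filterS => y Hy Dy; apply: rV_norm_le => [|k].
  by rewrite mulr_ge0 ?(ltW e0).
have := Hy k Dy; rewrite !mxE; under eq_bigr do rewrite !mxE.
by under [in X in _ -> X]eq_bigr do rewrite !mxE.
Qed.

Section manifold_facts.
Context (R : realType) (n : nat) (T : ptopologicalType) (M : smooth_atlas R n T).
Local Notation E := 'rV[R]_n.+1.
Implicit Types (i j : chart M) (p q : T).

Lemma coords_ge0 i p : dom i p -> 0 <= coords i p 0 0.
Proof.
move=> ip; have [U _ iU] := coord_image i.
have : (coords i @` dom i) (coords i p) by exists p.
by rewrite iU => -[].
Qed.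

Lemma coords_cvg i p : dom i p -> {for p, continuous (coords i)}.
Proof.
move=> ip; have := @Defs.coord_continuous _ _ _ M i.
by rewrite (continuous_open_subspace _ (open_dom i)); apply; rewrite inE.
Qed.

(** Chart images are relatively open in the half-space: the range is an open set cut by the
    half-space, and [param i] is continuous on it. *)
Lemma coords_open_image i p (A : set T) : open A -> A p -> dom i p ->
  \forall y \near coords i p, 0 <= (y : E) 0 0 ->
    exists q, [/\ A q, dom i q, coords i q = y & param i y = q].
Proof.
move=> oA Ap ip.
have [U oU iU] := coord_image i.
have xr : (coords i @` dom i) (coords i p) by exists p.
have Ux : U (coords i p) by move: xr; rewrite iU => -[].
have pc : param i y @[y --> within (coords i @` dom i) (nbhs (coords i p))] --> p.
  rewrite -[X in _ --> X](coordK ip).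
  exact: (subspace_continuousP _ _).1 (@param_continuous _ _ _ M i) _ xr.
have nA : nbhs p A by exact: open_nbhs_nbhs.
apply: filterS2 (open_nbhs_nbhs (conj oU Ux)) (pc _ nA) => y Uy Hy y0.
have yr : (coords i @` dom i) y by rewrite iU.
case: (yr) => q iq qy; exists q; split => //.
- by have := Hy yr; rewrite /= -qy coordK.
- by rewrite -qy coordK.
Qed.

Lemma transition_jacobian_exists i j p : dom i p -> dom j p ->
  exists J, is_transition_jacobian i j p J.
Proof.
move=> ip jp; apply: smooth_on_jacobian; last by exists p.
exact: transition_smooth.
Qed.

Variable g : riemannian_metric M.

Lemma gram_posdefP i p : dom i p -> posdef (gram g i p).
Proof. by move=> ip; split; [exact: gram_sym|move=> v; exact: gram_posdef]. Qed.

Lemma conorm2E i p (w : covector_field M) : dom i p -> minterior M p ->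
  conorm2 g w p = (ccomp w i p *m invmx (gram g i p) *m (ccomp w i p)^T) 0 0.
Proof.
move=> ip mp; rewrite /conorm2; have cp := dom_chart_at M p.
have [J HJ] := transition_jacobian_exists cp ip.
by rewrite (conorm_transition (gram_posdefP cp) (gram_posdefP ip)
  (gram_transition g cp ip HJ) (ccomp_transition w cp ip mp HJ)).
Qed.

(* Otherwise the first coordinate of chart j, read in chart i, has an interior
   minimum at p, so its differential, a column of an invertible Jacobian,
   vanishes. *)
Lemma boundary_chart_indep i j p : dom i p -> dom j p ->
  0 < coords i p 0 0 -> 0 < coords j p 0 0.
Proof.
move=> ip jp i0; have := coords_ge0 jp; rewrite le_eqVlt => /predU1P[j0|//].
have [J HJ] := transition_jacobian_exists ip jp.
set x := coords i p.
(* The metric gives this at once: the Gram matrix in chart i is invertible and has J as a factor, so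
   the inverse transition map need not be differentiated. *)
have uJ : J \in unitmx.
  have := posdef_unit (gram_posdefP ip); rewrite (gram_transition g ip jp HJ).
  by rewrite !unitmxE !det_mulmx !unitfE !mulf_eq0 !negb_or => /andP[/andP[]].
have nD : \forall y \near x, (coords i @` (dom i `&` dom j)) y /\ 0 <= coords j (param i y) 0 0.
  have n0 : \forall y \near x, 0 < (y : E) 0 0.
    have /cvgrPdist_lt/(_ _ i0) := @matrix_normedtype.coord_continuous R 1 n.+1 0 0 x.
    by apply: filterS => y /=; rewrite ltr_norml => /andP[_]; lra.
  apply: filterS2 n0 (coords_open_image (open_dom j) jp ip) => y y0 /(_ (ltW y0))[q [jq iq <- pq]].
  by split; [exists q|rewrite coordK// coords_ge0].
have J0 k : J k 0 = 0.
  apply/eqP; rewrite -normr_le0; apply/ler_addgt0Pl => e e0; rewrite addr0.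
  have := HJ e e0; rewrite near_withinE => HJe.
  have /nbhs_rVP[r r0 Hr] : \forall y \near x, 0 <= coords j (param i y) 0 0 /\
      `|(coords j \o param i) y - (coords j \o param i) x - (y - x) *m J| <= e * `|y - x|.
    by apply: filterS2 nD HJe => y [Dy y0] H; split => //; exact: H.
  (* Moving by s in direction k keeps the j-coordinate nonnegative, which bounds s J_k0 from below;
     s = r/2 and s = -r/2 together give |J_k0| <= e. *)
  have H s : `|s| < r -> s * J k 0 >= - (e * `|s|).
    move=> sr; have [|h0 h1] := Hr (x + s *: delta_mx 0 k).
      move=> l; rewrite !mxE eqxx /= addrAC subrr add0r normrM.
      by case: eqVneq => _; rewrite ?normr1 ?normr0 ?mulr1 ?mulr0.
    have {h1} := le_trans (rV_norm_coord _ 0) h1.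
    have -> : x + s *: delta_mx 0 k - x = s *: delta_mx 0 k by rewrite addrAC subrr add0r.
    rewrite -scalemxAl -rowE.
    have ent3 (u v w : E) : (u - v - w) 0 0 = u 0 0 - v 0 0 - w 0 0 by rewrite !mxE.
    have -> : s *: row k J = s *: row k J :> E by [].
    rewrite ent3 (_ : (s *: row k J : E) 0 0 = s * J k 0); last by rewrite !mxE.
    rewrite /= {2}/x coordK// -j0 subr0.
    have ns : `|s *: delta_mx 0 k : E| <= `|s|.
      apply: rV_norm_le => // l; rewrite !mxE eqxx /= normrM.
      by case: eqVneq => _; rewrite ?normr1 ?normr0 ?mulr1 ?mulr0.
    move=> /le_trans/(_ (ler_wpM2l (ltW e0) ns)).
    by rewrite ler_norml => /andP[_]; move: h0; lra.
  have := H (r / 2); have := H (- (r / 2)); rewrite normrN gtr0_norm; last by rewrite divr_gt0.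
  have r2 : r / 2 < r by lra.
  move=> /(_ r2); rewrite mulNr lerN2 [e * _]mulrC ler_pM2l ?divr_gt0// => h1.
  move=> /(_ r2); rewrite -mulrN ler_pM2l ?divr_gt0// => h2.
  by rewrite ler_norml h1 h2.
have : (delta_mx 0 0 : E) *m J^T = 0.
  by apply/rowP => k; rewrite -rowE !mxE J0.
move=> /(congr1 (mulmx^~ (invmx J^T))); rewrite mulmxK ?unitmx_tr// mul0mx.
by move=> /rowP/(_ 0); rewrite !mxE eqxx /= => /eqP; rewrite oner_eq0.
Qed.

Lemma minterior_coord i p : dom i p -> minterior M p <-> 0 < coords i p 0 0.
Proof.
move=> ip; split=> [mp|i0 [j jp j0]].
  rewrite lt_neqAle coords_ge0// andbT; apply/eqP => i0; apply: mp.
  by exists i.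
by have := boundary_chart_indep ip jp i0; rewrite j0 ltxx.
Qed.

Lemma open_minterior : open (minterior M).
Proof.
rewrite openE => p mp; have ip := dom_chart_at M p.
have i0 := (minterior_coord ip).1 mp.
have nd : nbhs p (dom (chart_at M p)) by apply: open_nbhs_nbhs; split=> //; exact: open_dom.
have c0 : (fun q => coords (chart_at M p) q 0 0) q @[q --> p] --> coords (chart_at M p) p 0 0.
  apply: (@continuous_comp _ _ _ (coords (chart_at M p)) (fun x : E => x 0 0) p).
    exact: coords_cvg.
  exact: matrix_normedtype.coord_continuous.
have H : \forall q \near p, 0 < coords (chart_at M p) q 0 0.
  by move/cvgrPdist_lt : c0 => /(_ _ i0); apply: filterS => q /=; rewrite ltr_norml => /andP[_]; lra.
by apply: filterS2 nd H => q dq /(minterior_coord dq).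
Qed.

End manifold_facts.

(** * The local estimate *)

(* In a chart box Q with interior part Ep (the side [x_0 > 0]), F is a test
   function, g = d_k F, chi a cutoff, dphi = d_k (g chi), and W, O are the k-th
   components of weak differentials of U and U - F. Testing both against g chi
   shows that W - O and g agree after pairing with g chi, which bounds
   [int g^2 chi] without identifying g with W - O almost everywhere. *)
Section weak_gradient.
Context d (T : measurableType d) (R : realType) (lam : {measure set T -> \bar R}).
Variables (Q Ep : set T).
Hypotheses (mQ : measurable Q) (mEp : measurable Ep) (EpQ : Ep `<=` Q).
Hypothesis lamQ : (lam Q < +oo)%E.

Lemma integral_support (f : T -> R) : (forall t, Q t -> ~ Ep t -> f t = 0) ->
  (\int[lam]_(t in Q) (f t)%:E = \int[lam]_(t in Ep) (f t)%:E)%E.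
Proof.
move=> f0; rewrite integral_mkcond [RHS]integral_mkcond; congr integral.
apply/funext => t; rewrite /patch; case: ifPn => [/set_mem Qt|nQ].
  by case: ifPn => // /negP nE; rewrite f0// => /mem_set.
by rewrite ifN//; apply: contra nQ => /set_mem /EpQ /mem_set.
Qed.

Lemma bounded_integrable (D : set T) (f : T -> R) (m : R) :
  measurable D -> D `<=` Q -> measurable_fun D f ->
  (forall t, D t -> `|f t| <= m) -> lam.-integrable D (EFin \o f).
Proof.
move=> mD DQ mf fm; apply: measurable_bounded_integrable => //.
- by apply: le_lt_trans lamQ; apply: le_measure => //; rewrite inE.
- by exists m; split; [exact: num_real|move=> x mx t /fm /le_trans; apply; exact: ltW].
Qed.

Lemma sq_integrable (f : T -> R) : measurable_fun Ep f ->
  (\int[lam]_(t in Ep) (f t ^+ 2)%:E < +oo)%E ->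
  lam.-integrable Ep (EFin \o (fun t => f t ^+ 2)).
Proof.
move=> mf foo; apply/integrableP; split; first exact: measurable_sq.
apply: le_lt_trans foo; rewrite le_eqVlt; apply/orP; left; apply/eqP.
by apply: eq_integral => t _ /=; rewrite ger0_norm ?sqr_ge0.
Qed.

(** As |f| <= 1 + f^2 and Q has finite measure, square integrability suffices against a bounded
    factor. *)
Lemma sq_integrableM (f h : T -> R) (m : R) : measurable_fun Ep f ->
  (\int[lam]_(t in Ep) (f t ^+ 2)%:E < +oo)%E ->
  measurable_fun Ep h -> (forall t, Ep t -> `|h t| <= m) ->
  lam.-integrable Ep (EFin \o (fun t => f t * h t)).
Proof.
move=> mf foo mh hm.
have i1 : lam.-integrable Ep (EFin \o cst m).
  by apply: (@bounded_integrable _ _ `|m|).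
have i2 : lam.-integrable Ep (EFin \o (fun t => m * f t ^+ 2)).
  exact: integrableZl (sq_integrable mf foo).
apply: le_integrable (integrableD mEp i1 i2) => //.
  by apply/measurable_EFinP; exact: measurable_funM.
move=> t Et /=; rewrite lee_fin normrM.
have m0 : 0 <= m by apply: le_trans (hm t Et).
have mf0 : 0 <= m * f t ^+ 2 by rewrite mulr_ge0 ?sqr_ge0.
rewrite [leRHS]ger0_norm ?addr_ge0//.
have f2 : `|f t| <= 1 + f t ^+ 2.
  rewrite -real_normK ?num_real//; have := sqr_ge0 (`|f t| - 1); nra.
rewrite (le_trans (ler_pM _ _ f2 (hm t Et)))//; lra.
Qed.

Variables (U W O F g chi dphi : T -> R) (m : R).
Hypotheses (mU : measurable_fun Ep U) (mW : measurable_fun Ep W)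
  (mO : measurable_fun Ep O).
Hypotheses (mF : measurable_fun Q F) (mg : measurable_fun Q g)
  (mchi : measurable_fun Q chi) (mdphi : measurable_fun Q dphi).
Hypotheses (Fm : forall t, Q t -> `|F t| <= m) (gm : forall t, Q t -> `|g t| <= m)
  (dphim : forall t, Q t -> `|dphi t| <= m) (chi01 : forall t, Q t -> 0 <= chi t <= 1).
Hypotheses (F0 : forall t, Q t -> ~ Ep t -> F t = 0)
  (g0 : forall t, Q t -> ~ Ep t -> g t = 0).
Hypotheses (Uoo : (\int[lam]_(t in Ep) (U t ^+ 2)%:E < +oo)%E)
  (Woo : (\int[lam]_(t in Ep) (W t ^+ 2)%:E < +oo)%E)
  (Ooo : (\int[lam]_(t in Ep) (O t ^+ 2)%:E < +oo)%E).
Hypothesis parts : (\int[lam]_(t in Q) (g t * (g t * chi t) + F t * dphi t)%:E = 0)%E.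
Hypothesis weakU : (\int[lam]_(t in Ep) (W t * (g t * chi t))%:E =
  - \int[lam]_(t in Ep) (U t * dphi t)%:E)%E.
Hypothesis weakUF : (\int[lam]_(t in Ep) (O t * (g t * chi t))%:E =
  - \int[lam]_(t in Ep) ((U t - F t) * dphi t)%:E)%E.

Lemma weak_gradient_bound : (\int[lam]_(t in Q) (g t ^+ 2 * chi t)%:E <=
  2%:E * (\int[lam]_(t in Ep) (W t ^+ 2)%:E + \int[lam]_(t in Ep) (O t ^+ 2)%:E))%E.
Proof.
have mEpS f : measurable_fun Q f -> measurable_fun Ep (f : T -> R).
  by move=> mf; apply: measurable_funS mf.
have phim t : Q t -> `|g t * chi t| <= m.
  move=> Qt; rewrite normrM (le_trans _ (gm Qt))// ler_piMr//.
  by have /andP[c0 c1] := chi01 Qt; rewrite ger0_norm.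
have mphi : measurable_fun Q (fun t => g t * chi t) by exact: measurable_funM.
have iW := sq_integrableM mW Woo (mEpS _ mphi) (fun t Et => phim t (EpQ Et)).
have iO := sq_integrableM mO Ooo (mEpS _ mphi) (fun t Et => phim t (EpQ Et)).
have iU := sq_integrableM mU Uoo (mEpS _ mdphi) (fun t Et => dphim (EpQ Et)).
have iF : lam.-integrable Q (EFin \o (fun t => F t * dphi t)).
  apply: (@bounded_integrable _ _ (m * m)) => //; first exact: measurable_funM.
  by move=> t Qt; rewrite normrM ler_pM// ?Fm ?dphim.
have ig : lam.-integrable Q (EFin \o (fun t => g t ^+ 2 * chi t)).
  apply: (@bounded_integrable _ _ (m * m)) => //.
    by apply: measurable_funM => //; exact: measurable_funX.
  by move=> t Qt; rewrite expr2 -mulrA normrM ler_pM// ?gm ?phim.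
have iFE : lam.-integrable Ep (EFin \o (fun t => F t * dphi t)) by apply: integrableS iF.
have igE : lam.-integrable Ep (EFin \o (fun t => g t ^+ 2 * chi t)) by apply: integrableS ig.
have iWO : lam.-integrable Ep (EFin \o (fun t => (W t - O t) * (g t * chi t))).
  have := integrableB mEp iW iO; congr (_.-integrable _ _).
  by apply/funext => t /=; rewrite -EFinB mulrBl.
set X := (\int[lam]_(t in Q) (g t ^+ 2 * chi t)%:E)%E.
have XE : X = (\int[lam]_(t in Ep) (g t ^+ 2 * chi t)%:E)%E.
  by apply: integral_support => t Qt nE; rewrite g0// expr0n mul0r.
(* Subtracting the two weak equations cancels U and leaves minus the integral of F dphi, which is X
   by [parts]. *)
have key : X = (\int[lam]_(t in Ep) ((W t - O t) * (g t * chi t))%:E)%E.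
  have e1 : (\int[lam]_(t in Ep) ((W t - O t) * (g t * chi t))%:E =
      \int[lam]_(t in Ep) (W t * (g t * chi t))%:E - \int[lam]_(t in Ep) (O t * (g t * chi t))%:E)%E.
    rewrite -integralB//=; apply: eq_integral => t _.
    by rewrite -EFinB mulrBl.
  have e2 : (\int[lam]_(t in Ep) ((U t - F t) * dphi t)%:E =
      \int[lam]_(t in Ep) (U t * dphi t)%:E - \int[lam]_(t in Ep) (F t * dphi t)%:E)%E.
    rewrite -integralB//=; apply: eq_integral => t _.
    by rewrite -EFinB mulrBl.
  have e3 : (\int[lam]_(t in Q) (g t * (g t * chi t) + F t * dphi t)%:E =
      X + \int[lam]_(t in Q) (F t * dphi t)%:E)%E.
    rewrite -integralD//=; apply: eq_integral => t _.
    by rewrite -EFinD mulrA expr2.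
  have e4 : (\int[lam]_(t in Q) (F t * dphi t)%:E = \int[lam]_(t in Ep) (F t * dphi t)%:E)%E.
    by apply: integral_support => t Qt nE; rewrite F0// mul0r.
  have Xfin : X \is a fin_num by exact: integrable_fin_num.
  have Ufin := integrable_fin_num mEp iU.
  have Ffin := integrable_fin_num mEp iFE.
  move: parts weakUF; rewrite e1 weakU e3 e4 => + ->; rewrite e2.
  move: Xfin Ufin Ffin => /=.
  case: (X) => // x _; case: (\int[lam]_(t in Ep) (U t * dphi t)%:E)%E => // v _.
  case: (\int[lam]_(t in Ep) (F t * dphi t)%:E)%E => // w _.
  by move=> -[?] /=; congr EFin; lra.
have Xfin : X \is a fin_num by exact: integrable_fin_num.
(* Young's inequality, with chi <= 1 and (W - O)^2 <= 2 (W^2 + O^2). Half of X is then absorbed on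
   the left, which is legitimate because X is finite. *)
have : (X <= (2^-1)%:E * X + (\int[lam]_(t in Ep) (W t ^+ 2)%:E + \int[lam]_(t in Ep) (O t ^+ 2)%:E))%E.
  rewrite {1}key {1}XE.
  have iW2 := sq_integrable mW Woo; have iO2 := sq_integrable mO Ooo.
  rewrite -integralZl//= -integralD//= -integralD//; last 2 first.
  - exact: integrableZl.
  - exact: integrableD.
  apply: le_integral => //.
  - by apply: integrableD => //; [exact: integrableZl|exact: integrableD].
  move=> t /set_mem Et /=; rewrite lee_fin.
  have /andP[c0 c1] := chi01 (EpQ Et).
  have H1 : 0 <= (g t - (W t - O t)) ^+ 2 * chi t by rewrite mulr_ge0 ?sqr_ge0.
  have H2 : 0 <= (W t - O t) ^+ 2 * (1 - chi t) by rewrite mulr_ge0 ?sqr_ge0 ?subr_ge0.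
  have H3 : 0 <= (W t + O t) ^+ 2 by rewrite sqr_ge0.
  nra.
set Y := (\int[lam]_(t in Ep) (W t ^+ 2)%:E + _)%E.
have Y0 : (0 <= Y)%E by apply: adde_ge0; exact: integral_sq_ge0.
move: Xfin; case: (X) => // x _; case: Y Y0 => // [y _|_ _]; last by rewrite gt0_muley ?leey// lte_fin.
by rewrite -!EFinM -EFinD !lee_fin; lra.
Qed.

End weak_gradient.

Section borel_sets.
Context (T : ptopologicalType).

Lemma open_borel (A : set T) : open A -> measurable (A : set (borel T)).
Proof. by move=> oA; exact: sub_sigma_algebra. Qed.

Lemma measurable_fun_borel d (X : measurableType d) (f : X -> T) :
  (forall A : set T, open A -> measurable (f @^-1` A)) ->
  measurable_fun setT (f : X -> borel T).
Proof.
by move=> fo; apply: (@measurability _ _ X (borel T) setT f (@open T) erefl) => _ [A oA <-]; rewrite setTI; exact: fo.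
Qed.

Lemma continuous_borel (R : realType) (A : set T) (f : T -> R) : open A ->
  (forall p, A p -> {for p, continuous f}) ->
  measurable_fun (A : set (borel T)) (f : borel T -> R).
Proof.
move=> oA cf; apply: (measurability _ (RGenOpens.measurableE R)) => _ [_ [a [b ->] <-]].
apply: open_borel; rewrite openE => p [Ap fp]; apply: filterI.
  exact: open_nbhs_nbhs.
have /(cf p Ap) : nbhs (f p) `]a, b[%classic by exact: open_nbhs_nbhs.
by [].
Qed.

End borel_sets.

(** * The Riemannian volume in a chart box *)

Section chart_measure.
Context (R : realType) (n : nat) (T : ptopologicalType) (M : smooth_atlas R n T).
Variable g : riemannian_metric M.
Local Notation E := 'rV[R]_n.+1.
Local Notation tup := (n.+1.-tuple (measurableTypeR R)).
Local Notation lam := (@lebesgue_tuple R n.+1).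
Implicit Types (i j : chart M) (p q : T).

Lemma gram_cvg i p k l : dom i p ->
  gram g i (param i y) k l @[y --> within (coord_range i) (nbhs (coords i p))] --> gram g i p k l.
Proof.
move=> ip; have xr : coord_range i (coords i p) by exists p.
have [U [F [oU Ux sF FE]]] := gram_smooth g k l xr.
have [cF _] := sF [::] _ Ux.
have -> : gram g i p k l = F (coords i p) by rewrite FE// coordK.
apply: cvg_trans (cvg_trans (cvg_app F (cvg_within _)) cF).
apply: near_eq_cvg; rewrite near_withinE.
by apply: filterS (open_nbhs_nbhs (conj oU Ux)) => y Uy Dy; rewrite FE.
Qed.

(** By continuity at p. The bounds on the density compare the volume with Lebesgue measure; those on
    the diagonal of the Gram matrix compare covector norms with components. *)
Lemma chart_bounds i p : dom i p -> exists (U : set E) (r s1 s2 : R),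
  [/\ open U /\ coord_range i = U `&` @half_space R n, 0 < r, 0 < s1, 0 < s2 &
    forall y : E, (forall k, `|y 0 k - coords i p 0 k| <= r) -> U y /\
      (0 <= y 0 0 -> s1 <= Num.sqrt (\det (gram g i (param i y))) <= s2 /\
         forall k, gram g i (param i y) k k <= s2)].
Proof.
move=> ip; set x := coords i p; have [U oU iU] := coord_image i.
have xr : coord_range i x by exists p.
have Ux : U x by move: (xr); rewrite /coord_range iU => -[].
have sc : Num.sqrt (\det (gram g i (param i y))) @[y --> within (coord_range i) (nbhs x)] -->
    Num.sqrt (\det (gram g i p)).
  apply: (@cvg_comp _ _ _ (fun y => \det (gram g i (param i y))) Num.sqrt).
    by apply: cvg_det => k l; exact: gram_cvg.
  exact: sqrt_continuous.
set s0 := Num.sqrt _ in sc.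
have s00 : 0 < s0 by rewrite sqrtr_gt0; apply: posdef_det_gt0; exact: gram_posdefP.
(* Strictly larger than the density and than every diagonal entry at p, so one constant serves both
   bounds nearby. *)
pose s2 := 2 * s0 + \sum_k `|gram g i p k k| + 1.
have sum0 : 0 <= \sum_k `|gram g i p k k| by exact: sumr_ge0.
have n1 : \forall y \near x, coord_range i y -> s0 / 2 < Num.sqrt (\det (gram g i (param i y))).
  have h : s0 / 2 < s0 by lra.
  exact: (cvgr_gt _ sc _ h).
have n2 : \forall y \near x, coord_range i y -> Num.sqrt (\det (gram g i (param i y))) < s2.
  have h : s0 < s2 by rewrite /s2; lra.
  exact: (cvgr_lt _ sc _ h).
have n3 : \forall y \near x, forall k, coord_range i y -> gram g i (param i y) k k < s2.
  apply: (@filter_forall _ _ (fun k (y : E) => coord_range i y -> gram g i (param i y) k k < s2) _ (nbhs_filter x)) => k.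
  have h : gram g i p k k < s2.
    have : `|gram g i p k k| <= \sum_k `|gram g i p k k|.
      by rewrite (bigD1 k)//= lerDl sumr_ge0.
    by have := ler_norm (gram g i p k k); rewrite /s2; lra.
  exact: (cvgr_lt _ (@gram_cvg i p k k ip) _ h).
have /nbhs_rVP[r1 r10 H1] := n1; have /nbhs_rVP[r2 r20 H2] := n2.
have /nbhs_rVP[r3 r30 H3] := n3.
have /nbhs_rVP[r4 r40 H4] : nbhs x U by exact: open_nbhs_nbhs.
pose r := Num.min (Num.min r1 r2) (Num.min r3 r4).
have r0 : 0 < r by rewrite !lt_min r10 r20 r30 r40.
have Hr (y : E) : (forall k, `|y 0 k - x 0 k| < r) -> U y /\ (0 <= (y : E) 0 0 ->
    s0 / 2 <= Num.sqrt (\det (gram g i (param i y))) <= s2 /\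
         forall k, gram g i (param i y) k k <= s2).
  move=> yx; have Uy : U y.
    by apply: H4 => k; rewrite (lt_le_trans (yx k))// !ge_min lexx !orbT.
  split=> // y0.
  have yr : coord_range i y by rewrite /coord_range iU.
  split=> [|k].
    rewrite !ltW//; [apply: H2|apply: H1] => // k;
      by rewrite (lt_le_trans (yx k))// !ge_min lexx ?orbT.
  by apply: ltW; apply: H3 => // l; rewrite (lt_le_trans (yx l))// !ge_min lexx ?orbT.
exists U, (r / 2), (s0 / 2), s2; split => //.
- by rewrite divr_gt0.
- by rewrite divr_gt0.
- by rewrite /s2; lra.
- by move=> y yr; apply: Hr => k; rewrite (le_lt_trans (yr k))//; lra.
Qed.

End chart_measure.

Section chart_box.
Context (R : realType) (n : nat) (T : ptopologicalType) (M : smooth_atlas R n T).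
Variable g : riemannian_metric M.
Variable mu : {measure set (borel T) -> \bar R}.
Hypothesis vol : is_riemannian_volume g mu.
Local Notation E := 'rV[R]_n.+1.
Local Notation tup := (n.+1.-tuple (measurableTypeR R)).
Local Notation lam := (@lebesgue_tuple R n.+1).

Variables (i : chart M) (p : T) (a b : nat -> R) (U : set E) (s1 s2 : R).
Hypotheses (s1_gt0 : 0 < s1) (s2_gt0 : 0 < s2).
Hypothesis oU : open U.
Hypothesis rangeU : coord_range i = U `&` @half_space R n.
Hypothesis boxU : rbox a b `<=` U.
Hypothesis s12 : forall y : E, rbox a b y -> 0 <= y 0 0 ->
  s1 <= Num.sqrt (\det (gram g i (param i y))) <= s2.

(** The box may cross the face x_0 = 0. [hbox] is its part that parametrizes the points of [mbox],
    and [pbox] the part that parametrizes those in the interior of the manifold. *)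
Definition hbox : set tup := [set t | cbox n.+1 a b t /\ 0 <= (tnth t ord0 : R)].
Definition pbox : set tup := [set t | cbox n.+1 a b t /\ 0 < (tnth t ord0 : R)].
Definition mbox : set T := [set q | dom i q /\ rbox a b (coords i q)].
(* Outside [hbox], theta takes the junk value p; the measure is restricted to
   [hbox] before being pushed forward along theta. *)
Definition theta (t : tup) : T := if t \in hbox then param i (tuple_row t) else p.

Lemma hboxP t : hbox t ->
  [/\ coord_range i (tuple_row t), theta t = param i (tuple_row t),
      mbox (theta t) & coords i (theta t) = tuple_row t].
Proof.
move=> ht; have [/rbox_row bt t0] := ht.
have yr : coord_range i (tuple_row t).
  by rewrite rangeU; split; [exact: boxU|rewrite /half_space /= tuple_rowE].
have te : theta t = param i (tuple_row t) by rewrite /theta mem_set.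
case: (yr) => q iq qt.
have te' : theta t = q by rewrite te -qt coordK.
by split=> //; rewrite /mbox/= te' qt.
Qed.

Lemma mbox_hbox q (t : tup) : mbox q -> tuple_row t = coords i q -> hbox t /\ theta t = q.
Proof.
move=> [iq bq] tq.
have ht : hbox t.
  by split; [apply/rbox_row; rewrite tq|rewrite -tuple_rowE tq; exact: coords_ge0].
by split => //; have [_ -> _ _] := hboxP ht; rewrite tq coordK.
Qed.

Lemma measurable_half (c : bool) : measurable [set t : tup | if c then 0 <= (tnth t ord0 : R) else 0 < (tnth t ord0 : R)].
Proof.
have mt : measurable_fun [set: tup] (fun t : tup => tnth t ord0) by exact: measurable_tnth.
case: c.
- rewrite (_ : [set _ | _] = [set: tup] `&` (fun t : tup => tnth t ord0) @^-1` `[0, +oo[%classic).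
    exact: mt.
  by apply/seteqP; split=> t /=; rewrite in_itv /= andbT => // -[].
- rewrite (_ : [set _ | _] = [set: tup] `&` (fun t : tup => tnth t ord0) @^-1` `]0, +oo[%classic).
    exact: mt.
  by apply/seteqP; split=> t /=; rewrite in_itv /= andbT => // -[].
Qed.

Lemma measurable_hbox : measurable hbox.
Proof. by apply: measurableI; [exact: measurable_cbox|exact: (measurable_half true)]. Qed.

Lemma measurable_pbox : measurable pbox.
Proof. by apply: measurableI; [exact: measurable_cbox|exact: (measurable_half false)]. Qed.

Lemma measurable_theta : measurable_fun setT (theta : tup -> borel T).
Proof.
apply: measurable_fun_borel => A oA.
have [V oV VA] : exists2 V : set E, open V & V `&` coord_range i = param i @^-1` A `&` coord_range i.
  apply/open_subspaceP; move: A oA; apply/continuousP.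
  exact: (@param_continuous _ _ _ M i).
rewrite (_ : theta @^-1` A = (hbox `&` [set t | V (tuple_row t)]) `|` (~` hbox `&` [set _ | A p])).
  apply: measurableU; apply: measurableI.
  - exact: measurable_hbox.
  - exact: open_tuple_measurable.
  - by apply: measurableC; exact: measurable_hbox.
  - have [Ap|nAp] := pselect (A p).
      by rewrite (_ : [set _ | _] = setT)//; apply/seteqP; split.
    by rewrite (_ : [set _ | _] = set0)//; apply/seteqP; split.
apply/seteqP; split=> t /=.
- move=> At; have [ht|ht] := pselect (hbox t); [left|right].
    have [yr te _ _] := hboxP ht; split=> //.
    have : (param i @^-1` A `&` coord_range i) (tuple_row t) by split=> //=; rewrite -te.
    by rewrite -VA => -[].
  by split=> //; move: At; rewrite /theta memNset.
- move=> [[ht Vt]|[ht Ap]]; last by rewrite /theta memNset.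
  have [yr te _ _] := hboxP ht.
  have : (V `&` coord_range i) (tuple_row t) by [].
  by rewrite VA te => -[].
Qed.

Lemma open_coords_preimage (V : set E) : open V -> open [set q | dom i q /\ V (coords i q)].
Proof.
move=> oV; rewrite openE => q [iq Vq]; apply: filterI.
  by apply: open_nbhs_nbhs; split => //; exact: open_dom.
have /(coords_cvg iq) : nbhs (coords i q) V by exact: open_nbhs_nbhs.
by [].
Qed.

Lemma measurable_mbox : measurable (mbox : set (borel T)).
Proof.
rewrite (_ : mbox = dom i `\` [set q | dom i q /\ (~` @rbox R n.+1 a b) (coords i q)]).
  apply: measurableD; apply: open_borel; first exact: open_dom.
  apply: open_coords_preimage; apply: closed_openC.
  by apply: compact_closed; [exact: norm_hausdorff|exact: compact_rbox].
apply/seteqP; split=> q /=; first by move=> [iq bq]; split => // -[].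
by move=> [iq nq]; split=> //; apply: contrapT => nb; apply: nq.
Qed.

Lemma preimage_theta (A : set T) : A `<=` mbox ->
  theta @^-1` A `&` hbox = [set t | (coords i @` A) (tuple_row t)].
Proof.
move=> AD; apply/seteqP; split=> t /=.
  by move=> [At ht]; have [_ _ _ ct] := hboxP ht; exists (theta t).
by move=> [q Aq qt]; have [ht ->] := mbox_hbox (AD _ Aq) (esym qt).
Qed.

(** By [vol], mu A is the integral of the density over the coordinate image of A, which is the
    stated preimage under [theta] within [hbox]. *)
Lemma volume_bounds (A : set (borel T)) : measurable A -> A `<=` mbox ->
  (s1%:E * lam (theta @^-1` A `&` hbox) <= mu A)%E /\
  (mu A <= s2%:E * lam (theta @^-1` A `&` hbox))%E.
Proof.
move=> mA AD; have AI : A `<=` dom i by move=> q /AD[].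
have mE : measurable (theta @^-1` A `&` hbox).
  apply: measurableI; last exact: measurable_hbox.
  by rewrite -[theta @^-1` A]setTI; exact: measurable_theta.
rewrite (vol mA AI) /lebesgue_int -(preimage_theta AD).
have b12 t : (theta @^-1` A `&` hbox) t ->
    s1 <= Num.sqrt (\det (gram g i (param i (tuple_row t)))) <= s2.
  by move=> [_ [/rbox_row bt t0]]; apply: s12 => //; rewrite tuple_rowE.
split; rewrite -integral_cst//; apply: ge0_le_integral_nomeas => // t Et; rewrite ?lee_fin ?sqrtr_ge0//.
- exact: ltW.
- by have /andP[] := b12 t Et.
- exact: ltW.
- by have /andP[] := b12 t Et.
Qed.

(** With nu the pushforward by [theta] of Lebesgue measure restricted to [hbox], [volume_bounds]
    says s1 nu <= mu <= s2 nu on subsets of [mbox], and the integrals follow. *)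
Lemma chart_integral_bounds (D : set (borel T)) (h : borel T -> \bar R) :
  measurable D -> D `<=` mbox -> measurable_fun D h -> (forall q, D q -> 0 <= h q)%E ->
  (s1%:E * \int[lam]_(t in theta @^-1` D `&` hbox) h (theta t) <= \int[mu]_(q in D) h q)%E /\
  (\int[mu]_(q in D) h q <= s2%:E * \int[lam]_(t in theta @^-1` D `&` hbox) h (theta t))%E.
Proof.
move=> mD Dm mh h0.
pose nu : {measure set (borel T) -> \bar R} :=
  measure_function_pushforward__canonical__measure_function_Measure
    (mrestr lam measurable_hbox) measurable_theta.
have mtD : measurable (theta @^-1` D).
  by rewrite -[theta @^-1` D]setTI; exact: measurable_theta.
have nuE : (\int[nu]_(q in D) h q = \int[lam]_(t in theta @^-1` D `&` hbox) h (theta t))%E.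
  transitivity (\int[mrestr lam measurable_hbox]_(t in theta @^-1` D) h (theta t))%E.
    apply: (ge0_integral_pushforward measurable_theta) => //.
    by move=> q /set_mem; exact: h0.
  rewrite ge0_integral_mrestr//.
  - apply: (measurable_comp mD) => [_ [t Dt <-] //|//|].
    by apply: measurable_funTS; exact: measurable_theta.
  - by move=> t; exact: h0.
split.
- rewrite -nuE -[s1]/((NngNum (ltW s1_gt0))%:num) -ge0_integral_mscale//.
  apply: le_measure_integral_on => // S mS SD.
  by have [] := volume_bounds mS (subset_trans SD Dm).
- rewrite -nuE -[s2]/((NngNum (ltW s2_gt0))%:num) -ge0_integral_mscale//.
  apply: le_measure_integral_on => // S mS SD.
  by have [] := volume_bounds mS (subset_trans SD Dm).
Qed.

End chart_box.

Section open_half_spaces.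
Context (R : realType) (n : nat).
Local Notation E := 'rV[R]_n.+1.

Lemma open_coord_gt0 : open [set y : E | 0 < y 0 0].
Proof.
rewrite openE => y y0; apply/nbhs_rVP; exists (y 0 0) => // z /(_ 0).
by rewrite /= ltr_norml => /andP[]; lra.
Qed.

Lemma open_coord_lt0 : open [set y : E | y 0 0 < 0].
Proof.
rewrite openE => y y0; apply/nbhs_rVP; exists (- y 0 0); first by rewrite oppr_gt0.
by move=> z /(_ 0); rewrite /= ltr_norml => /andP[]; lra.
Qed.

Lemma open_locally0 (F : E -> R) : open [set y : E | \forall z \near y, F z = 0].
Proof. by rewrite openE => y /=; exact: nbhs_interior. Qed.

End open_half_spaces.

(** * Extension by zero across the boundary *)

Section compactly_supported.
Context (R : realType) (n : nat) (T : ptopologicalType) (M : smooth_atlas R n T).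
Local Notation E := 'rV[R]_n.+1.
Hypothesis hT : hausdorff_space T.
Variable g : riemannian_metric M.
Variable f : T -> R.
Hypothesis fM : smooth_compact_support M f.

Lemma smooth_continuous q : {for q, continuous f}.
Proof.
pose i := chart_at M q; have iq : dom i q := dom_chart_at M q.
have qr : coord_range i (coords i q) by exists q.
have [V [G [oV Vx sG GE]]] := fM.1 i _ qr.
have [cG _] := sG [::] _ Vx.
have nd : nbhs q (dom i) by apply: open_nbhs_nbhs; split => //; exact: open_dom.
have nV : nbhs q (coords i @^-1` V) by apply: (coords_cvg iq); exact: open_nbhs_nbhs.
have fG z : dom i z -> V (coords i z) -> G (coords i z) = f z.
  by move=> iz Vz; rewrite GE /= ?coordK//; exists z.
rewrite /prop_for /continuous_at -(fG q)//.
apply: cvg_trans (continuous_comp (coords_cvg iq) cG).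
apply: near_eq_cvg.
by apply: filterS2 nd nV => z iz Vz /=; rewrite fG.
Qed.

Variables (i : chart M) (U : set E).
Hypothesis oU : open U.
Hypothesis rangeU : coord_range i = U `&` @half_space R n.

(* f vanishes near the boundary, so its extension by zero is smooth across it. *)
Definition fext (y : E) : R := if 0 <= y 0 0 then f (param i y) else 0.

(** The case y_0 < 0 holds by construction. If y_0 = 0, the point lies on the boundary, hence off
    the compact set K carrying f; K is closed since T is Hausdorff, so by [coords_open_image] the
    nearby points of the half-space also land off K. *)
Lemma fext_locally0 y : U y -> y 0 0 <= 0 -> \forall z \near y, fext z = 0.
Proof.
move=> Uy; rewrite le_eqVlt => /predU1P[y0|y0]; last first.
  apply: filterS (open_nbhs_nbhs (conj (@open_coord_lt0 R n) y0)) => z z0.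
  by rewrite /fext leNgt z0.
have : coord_range i y by rewrite rangeU; split; rewrite /half_space /= ?y0.
move=> [q iq qy]; have [K [cK KM K0]] := fM.2.
have nKq : (~` K) q by move=> /KM; apply; exists i; rewrite // qy.
have oK : open (~` K) by apply: closed_openC; exact: compact_closed.
have := coords_open_image oK nKq iq; rewrite qy; apply: filterS => z Hz.
rewrite /fext; case: ifPn => // /Hz[q' [nKq' _ _ ->]]; exact: K0.
Qed.

Lemma fext_eq0 y : U y -> y 0 0 <= 0 -> fext y = 0.
Proof. by move=> Uy y0; exact: nbhs_singleton (fext_locally0 Uy y0). Qed.

Lemma fext_partial_eq0 y k : U y -> y 0 0 <= 0 -> partial k fext y = 0.
Proof.
move=> Uy y0; rewrite /partial (near_eq_derive _ (fext_locally0 Uy y0)).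
exact: derive_cst.
Qed.

Lemma fext_smooth : smooth_open U fext.
Proof.
apply: smooth_open_local => y Uy; have [y0|y0] := leP (y 0 0) 0.
  exists [set y : E | \forall z \near y, fext z = 0], (cst 0); split.
  - exact: open_locally0.
  - exact: fext_locally0.
  - exact: smooth_open_cst.
  - by move=> z Vz; rewrite (nbhs_singleton Vz).
have yr : coord_range i y by rewrite rangeU; split; rewrite // /half_space /= ltW.
have [V [G [oV Vy sG GE]]] := fM.1 i _ yr.
exists (V `&` U `&` [set z : E | 0 < z 0 0]), G; split=> //.
- by apply: openI; [exact: openI|exact: open_coord_gt0].
- by apply: smooth_openW sG => z [[]].
- move=> z [[Vz Uz] z0]; rewrite /fext (ltW z0) GE//.
  by rewrite -/(coord_range i) rangeU; split; rewrite // /half_space /= ltW.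
Qed.

Lemma partial_cutoff_test a b (chi : E -> R) k : rbox a b `<=` U ->
  smooth_open setT chi -> (forall y, ~ rbox a b y -> chi y = 0) ->
  test_function (coord_interior i) (partial k fext * chi).
Proof.
move=> abU schi chi0.
have cR : closed (@rbox R n.+1 a b).
  by apply: compact_closed; [exact: norm_hausdorff|exact: compact_rbox].
split.
  apply: smooth_open_local => y _; have [Uy|Uy] := pselect (U y).
    exists U, (partial k fext * chi); split=> //.
    apply: smooth_openM => //; last by apply: smooth_openW schi.
    exact/smooth_open_partial/fext_smooth.
  exists (~` @rbox R n.+1 a b), (cst 0); split.
  - exact: closed_openC.
  - by move=> /abU.
  - exact: smooth_open_cst.
  - by move=> z nz; rewrite [RHS]/GRing.mul/= chi0// mulr0.
(* The box may cross the boundary and chi need not vanish there; removing the open set where [fext]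
   vanishes locally leaves a compact subset of y_0 > 0. *)
exists (rbox a b `&` ~` [set y : E | \forall z \near y, fext z = 0]); split.
- apply: (@subclosed_compact _ _ (@rbox R n.+1 a b)).
  + by apply: closedI => //; apply: open_closedC; exact: open_locally0.
  + exact: compact_rbox.
  + by move=> y [].
- move=> y [by_ ny]; have Uy := abU y by_.
  have y0 : 0 < y 0 0 by rewrite ltNge; apply/negP => /(fext_locally0 Uy)/ny.
  have : coord_range i y by rewrite rangeU; split; rewrite // /half_space /= ltW.
  move=> [q iq qy]; exists q => //; split=> //.
  by apply/(minterior_coord g iq); rewrite qy.
- move=> y ny; have [by_|nby] := pselect (rbox a b y); last first.
    by rewrite [LHS]/GRing.mul/= chi0// mulr0.
  have Fy : \forall z \near y, fext z = 0 by apply: contrapT => H; apply: ny.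
  rewrite [LHS]/GRing.mul/= {1}/partial (near_eq_derive _ Fy).
  by rewrite derive_cst mul0r.
Qed.

End compactly_supported.

Lemma partialM (R : realType) n (f h : 'rV[R]_n -> R) x (k : 'I_n) :
  derivable f x (delta_mx 0 k) -> derivable h x (delta_mx 0 k) ->
  partial k (f * h) x = partial k f x * h x + f x * partial k h x.
Proof.
move=> df dh; apply: etrans (deriveM df dh) _.
by rewrite addrC; congr (_ + _); exact: mulrC.
Qed.

(** * Gradient bound and Poincaré inequality in a chart *)

Section local_estimate.
Context (R : realType) (n : nat) (T : ptopologicalType) (M : smooth_atlas R n T).
Variable g : riemannian_metric M.
Variable mu : {measure set (borel T) -> \bar R}.
Hypothesis vol : is_riemannian_volume g mu.
Hypothesis hT : hausdorff_space T.
Local Notation E := 'rV[R]_n.+1.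
Local Notation tup := (n.+1.-tuple (measurableTypeR R)).
Local Notation lam := (@lebesgue_tuple R n.+1).

Variables (i : chart M) (p : T) (a b : nat -> R) (U : set E) (s1 s2 : R).
Hypotheses (s1_gt0 : 0 < s1) (s2_gt0 : 0 < s2).
Hypothesis oU : open U.
Hypothesis rangeU : coord_range i = U `&` @half_space R n.
Hypothesis boxU : rbox a b `<=` U.
Hypothesis s12 : forall y : E, rbox a b y -> 0 <= y 0 0 ->
  s1 <= Num.sqrt (\det (gram g i (param i y))) <= s2.
Hypothesis gram_le : forall (y : E) k, rbox a b y -> 0 <= y 0 0 ->
  gram g i (param i y) k k <= s2.

Local Notation theta := (theta i p a b).
Local Notation hbox := (@hbox R n a b).
Local Notation pbox := (@pbox R n a b).
Local Notation mbox := (mbox i a b).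

Lemma pbox_hbox t : pbox t -> hbox t.
Proof. by move=> [ct t0]; split => //; exact: ltW. Qed.

Lemma theta_pbox t : hbox t -> (minterior M (theta t) <-> pbox t).
Proof.
move=> ht; have [yr _ [it _] ct] := hboxP p rangeU boxU ht.
rewrite (minterior_coord g it) ct tuple_rowE; split; last by case.
by move=> t0; split => //; case: ht.
Qed.

Lemma preimage_theta_interior : theta @^-1` (mbox `&` minterior M) `&` hbox = pbox.
Proof.
apply/seteqP; split=> t /=.
  by move=> [[_ mt] ht]; exact/theta_pbox.
move=> pt; have ht := pbox_hbox pt; have [_ _ mt _] := hboxP p rangeU boxU ht.
by split => //; split => //; exact/theta_pbox.
Qed.

(** Within the box the coordinate interior is exactly x_0 > 0, so the integrals in
    [weak_differential] reduce to [pbox] for functions supported in the box. *)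
Lemma lebesgue_int_pbox (h : E -> R) : (forall y, ~ rbox a b y -> h y = 0) ->
  lebesgue_int (coord_interior i) h = (\int[lam]_(t in pbox) (h (tuple_row t))%:E)%E.
Proof.
move=> h0; rewrite /lebesgue_int integral_mkcond [RHS]integral_mkcond; congr integral.
apply/funext => t; rewrite /patch.
have [bt|nbt] := pselect (rbox a b (tuple_row t)); last by rewrite h0//; do 2 case: ifP.
suff -> : (t \in [set t : tup | coord_interior i (tuple_row t)]) = (t \in pbox) by [].
apply/idP/idP => /set_mem Ht; apply/mem_set.
  have [q [iq mq] qt] := Ht; split; first exact/rbox_row.
  by rewrite -tuple_rowE -qt; exact/(minterior_coord g iq).
have ht := pbox_hbox Ht; have [_ _ [it _] ct] := hboxP p rangeU boxU ht.
by exists (theta t) => //; split => //; exact/theta_pbox.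
Qed.

Lemma measurable_interior_box : measurable (mbox `&` minterior M : set (borel T)).
Proof.
apply: measurableI; first exact: measurable_mbox.
by apply: open_borel; exact: open_minterior g.
Qed.

Lemma pbox_measurable_comp (h : T -> R) :
  measurable_fun (mbox `&` minterior M : set (borel T)) (h : borel T -> R) ->
  measurable_fun pbox (fun t => h (theta t)).
Proof.
move=> mh.
have -> : (fun t => h (theta t)) = (h : borel T -> R) \o (theta : tup -> borel T) by [].
apply: (measurable_comp measurable_interior_box) => // [_ [t pt <-]|].
  have ht := pbox_hbox pt; have [_ _ mt _] := hboxP p rangeU boxU ht.
  by split => //; exact/theta_pbox.
by apply: measurable_funTS; exact: (@measurable_theta _ _ _ _ i p a b U).
Qed.

(** The weight C is 1 for functions and 1/s2 for components of covectors, whose squares are at most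
    s2 times [conorm2]. *)
Lemma pbox_integral_sq (h : T -> R) (C : R) (N : \bar R) :
  measurable_fun (mbox `&` minterior M : set (borel T)) (h : borel T -> R) ->
  0 < C ->
  (C%:E * \int[mu]_(q in (mbox `&` minterior M : set (borel T))) (h q ^+ 2)%:E <= N)%E ->
  (\int[lam]_(t in pbox) (h (theta t) ^+ 2)%:E <= (C * s1)^-1%:E * N)%E.
Proof.
move=> mh C0 hN.
have [H _] := @chart_integral_bounds _ _ _ _ _ _ vol i p a b U s1 s2 s1_gt0 s2_gt0
  rangeU boxU s12 _ (fun q => (h q ^+ 2)%:E) measurable_interior_box (@subIsetl _ _ _)
  (measurable_sq mh) (fun q _ => sqr_ge0 (h q)).
have Cs : 0 < C * s1 by rewrite mulr_gt0.
rewrite -lee_pdivrMl ?invr_gt0// invrK; apply: le_trans hN.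
rewrite EFinM -muleA lee_wpmul2l ?lee_fin ?(ltW C0)//.
by move: H; rewrite preimage_theta_interior.
Qed.

Lemma pbox_covector_sq (w : covector_field M) k : form_L2 g mu w ->
  measurable_fun (mbox `&` minterior M : set (borel T)) (fun q : borel T => ccomp w i q 0 k) /\
  (\int[lam]_(t in pbox) (ccomp w i (theta t) 0 k ^+ 2)%:E <= (s2 / s1)%:E * form_L2norm2 g mu w)%E.
Proof.
move=> [mw _].
have mwk : measurable_fun (mbox `&` minterior M : set (borel T)) (fun q : borel T => ccomp w i q 0 k).
  apply: measurable_funS (mw i k).
    by apply: measurableI; apply: open_borel; [exact: open_dom|exact: open_minterior g].
  by move=> q [[iq _] mq].
split => //.
have -> : s2 / s1 = (s2^-1 * s1)^-1 by rewrite invfM invrK.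
apply: (pbox_integral_sq mwk); first by rewrite invr_gt0.
rewrite -ge0_integralZl//; last 4 first.
- exact: measurable_interior_box.
- exact: measurable_sq.
- by move=> q _; rewrite lee_fin sqr_ge0.
- by rewrite lee_fin invr_ge0 ltW.
apply: ge0_le_integral_nomeas.
- by move=> q [].
- by move=> q _; rewrite -EFinM lee_fin mulr_ge0 ?sqr_ge0// invr_ge0 ltW.
- move=> q mq; rewrite lee_fin /conorm2; apply: posdef_inv_ge0.
  by apply: gram_posdefP; exact: dom_chart_at.
- move=> q [[iq bq] mq]; rewrite (conorm2E _ _ iq mq) -EFinM lee_fin.
  rewrite ler_pdivrMl//.
  apply: le_trans (posdef_coord_le _ _ (gram_posdefP g iq)) _.
  rewrite ler_wpM2r//; first by apply: posdef_inv_ge0; exact: gram_posdefP.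
  by rewrite -{1}(coordK iq); apply: gram_le => //; exact: coords_ge0.
Qed.

(** No closeness of f to u is asked; it enters only when the final limit is taken. *)
Definition H10_approx (f u : T -> R) (du om : covector_field M) : Prop :=
  [/\ smooth_compact_support M f, L2 M mu u, is_differential g mu u du &
      is_differential g mu (u \- f) om].

Lemma gradient_cutoff_bound f u du om (chi : E -> R) k :
  H10_approx f u du om -> (forall j, a j <= b j) ->
  smooth_open setT chi -> (forall y, 0 <= chi y <= 1) ->
  (forall (y : E) (j : 'I_n.+1), ~ (a j < y 0 j < b j) -> chi y = 0) ->
  (\int[lam]_(t in cbox n.+1 a b)
      (partial k (fext f i) (tuple_row t) ^+ 2 * chi (tuple_row t))%:E <=
   2%:E * ((s2 / s1)%:E * form_L2norm2 g mu du + (s2 / s1)%:E * form_L2norm2 g mu om))%E.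
Proof.
move=> [fM uL2 [duL2 wu] [omL2 wom]] ab schi chi01 chiab.
have chi0 y : ~ rbox a b y -> chi y = 0.
  move=> nby; apply: contrapT => c0; apply: nby => j.
  apply: contrapT => nj; apply: c0; apply: (chiab y j) => /andP[aj bj].
  by apply: nj; rewrite !ltW.
set F := fext f i; pose phi : E -> R := partial k F * chi.
have sF : smooth_open U F by exact: (fext_smooth hT fM oU rangeU).
have phi_test : test_function (coord_interior i) phi.
  exact: (partial_cutoff_test hT g fM oU rangeU k boxU schi chi0).
have phi0 y : ~ rbox a b y -> phi y = 0.
  by move=> nby; rewrite [LHS]/GRing.mul /= chi0// mulr0.
have cR : closed (@rbox R n.+1 a b).
  by apply: compact_closed; [exact: norm_hausdorff|exact: compact_rbox].
have dphi0 y : ~ rbox a b y -> partial k phi y = 0.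
  move=> nby; have nr : \forall z \near y, phi z = cst 0 z.
    by apply: filterS (open_nbhs_nbhs (conj (closed_openC cR) nby)) => z; exact: phi0.
  by rewrite /partial (near_eq_derive _ nr) derive_cst.
have [_ duoo] := pbox_covector_sq k duL2.
have [_ omoo] := pbox_covector_sq k omL2.
have [mdu _] := pbox_covector_sq k duL2.
have [mom _] := pbox_covector_sq k omL2.
have F1 := smooth_open_C1 sF.
have phi1 := smooth_open_C1 phi_test.1.
have [m1 m10 Fm] := rbox_bounded boxU (fun x Ux => let: And3 c _ _ := F1 x Ux in c).
have [m2 m20 gm] := rbox_bounded boxU (fun x Ux => let: And3 _ _ c := F1 x Ux in c k).
have [m3 m30 dm] := rbox_bounded (@subsetT _ (@rbox R n.+1 a b)) (fun x Ux => let: And3 _ _ c := phi1 x Ux in c k).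
have cU (t : tup) : cbox n.+1 a b t -> U (tuple_row t) by move=> /rbox_row/boxU.
have mcont (V : set E) (h : E -> R) : open V -> rbox a b `<=` V ->
    (forall x, V x -> {for x, continuous h}) ->
    measurable_fun (cbox n.+1 a b) (fun t : tup => h (tuple_row t)).
  move=> oV bV ch; apply: measurable_funS (continuous_tuple_measurable oV ch).
    exact: open_tuple_measurable.
  by move=> t /rbox_row /bV.
have [m4 m40 Hm] := rbox_bounded boxU (fun x Ux =>
  let: And3 _ _ c := smooth_open_C1 (smooth_openM oU sF (smooth_openW (@subsetT _ U) phi_test.1)) Ux in c k).
have s2s1 : 0 < s2 / s1 by rewrite divr_gt0.
(* The weak equation tested against phi = chi d_k F; phi and its derivative vanish off the box,
   which confines both integrals to [pbox]. *)
have weak (v : T -> R) (w : covector_field M) : weak_differential v w ->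
    (\int[lam]_(t in pbox) (ccomp w i (theta t) 0 k * (partial k F (tuple_row t) * chi (tuple_row t)))%:E =
     - \int[lam]_(t in pbox) (v (theta t) * partial k phi (tuple_row t))%:E)%E.
  move=> /(_ i k phi phi_test).
  rewrite lebesgue_int_pbox; last by move=> y nby; rewrite phi0// mulr0.
  rewrite lebesgue_int_pbox; last by move=> y nby; rewrite dphi0// mulr0.
  have te t : t \in pbox -> param i (tuple_row t) = theta t.
    by move=> /set_mem/pbox_hbox ht; have [_ ->] := hboxP p rangeU boxU ht.
  under eq_integral => t pt do rewrite te//.
  by under [X in _ = (- X)%E -> _]eq_integral => t pt do rewrite te//.
have mu' : measurable_fun (mbox `&` minterior M : set (borel T)) (u : borel T -> R).
  by apply: measurable_funS uL2.1 => //; apply: open_borel; exact: open_minterior g.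
have Uoo : (\int[lam]_(t in pbox) (u (theta t) ^+ 2)%:E < +oo)%E.
  apply: (@le_lt_trans _ _ ((1 * s1)^-1%:E * L2norm2 M mu u)%E).
    apply: pbox_integral_sq => //; rewrite mul1e.
    by apply: ge0_le_integral_nomeas => [q []|q _|q _|] //; rewrite lee_fin sqr_ge0.
  by rewrite lte_mul_pinfty ?lee_fin ?invr_ge0 ?mul1r ?(ltW s1_gt0)//; exact: uL2.2.
have lt_form (w : covector_field M) (X : \bar R) : (form_L2norm2 g mu w < +oo)%E ->
    (X <= (s2 / s1)%:E * form_L2norm2 g mu w)%E -> (X < +oo)%E.
  by move=> woo /le_lt_trans; apply; rewrite lte_mul_pinfty// lee_fin ltW.
have pQ : pbox `<=` cbox n.+1 a b by move=> t [].
have nE (t : tup) : cbox n.+1 a b t -> ~ pbox t -> (tuple_row t) 0 0 <= 0.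
  by move=> ct np; rewrite leNgt tuple_rowE; apply/negP => t0; apply: np.
have := @weak_gradient_bound _ _ _ lam (cbox n.+1 a b) pbox (@measurable_cbox _ _ _ _)
  (@measurable_pbox _ _ _ _) pQ (cbox_lt_pinfty _ ab) (fun t => u (theta t))
  (fun t => ccomp du i (theta t) 0 k) (fun t => ccomp om i (theta t) 0 k)
  (fun t => F (tuple_row t)) (fun t => partial k F (tuple_row t))
  (fun t => chi (tuple_row t)) (fun t => partial k phi (tuple_row t)) (m1 + m2 + m3)
  (pbox_measurable_comp mu') (pbox_measurable_comp mdu) (pbox_measurable_comp mom).
move=> /(_ (mcont U F oU boxU (fun x Ux => let: And3 c _ _ := F1 x Ux in c))).
move=> /(_ (mcont U (partial k F) oU boxU (fun x Ux => let: And3 _ _ c := F1 x Ux in c k))).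
move=> /(_ (mcont setT chi openT (@subsetT _ _) (fun x Ux => (schi [::] x Ux).1))).
move=> /(_ (mcont setT (partial k phi) openT (@subsetT _ _) (fun x Ux => let: And3 _ _ c := phi1 x Ux in c k))).
move=> H; apply: le_trans (H _ _ _ _ _ _ _ _ _ _ _ _) _.
- move=> t /rbox_row/Fm; lra.
- move=> t /rbox_row/gm; lra.
- move=> t /rbox_row/dm; lra.
- by move=> t _; exact: chi01.
- by move=> t ct /(nE t ct); apply: (fext_eq0 hT fM rangeU); exact: cU.
- by move=> t ct /(nE t ct); apply: (fext_partial_eq0 hT fM rangeU); exact: cU.
- exact: Uoo.
- exact: lt_form duL2.2 duoo.
- exact: lt_form omL2.2 omoo.
(* Integration by parts: the integrand is d_k (F phi), and F phi vanishes on the faces of the box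
   because chi does. *)
- have sH : smooth_open U (F * phi).
    exact: smooth_openM oU sF (smooth_openW (@subsetT _ U) phi_test.1).
  have H1 := smooth_open_C1 sH.
  rewrite -[RHS](@cbox_integral_derive0 _ n.+1 k a b (fun t => (F * phi) (tuple_row t))
    (fun k t => partial k (F * phi) (tuple_row t)) m4 ab _ _ (C1_line_C1 H1 cU)).
  + apply: eq_integral => t /set_mem ct; congr (_%:E).
    have [_ dF _] := F1 _ (cU _ ct); have [_ dphi _] := phi1 (tuple_row t) I.
    exact: esym (partialM (dF k) (dphi k)).
  + exact: (mcont U _ oU boxU (fun x Ux => let: And3 _ _ c := H1 x Ux in c k)).
  + by move=> t /rbox_row/Hm.
  + move=> t ct; have chiend s : ~ (a k < s < b k) -> (F * phi) (tuple_row (upd t k s)) = 0.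
      move=> ns; rewrite [LHS]/GRing.mul/= [X in _ * X]/GRing.mul/= (chiab _ k) ?mulr0//.
      by rewrite tuple_rowE tnth_mktuple eqxx.
    by rewrite !chiend// ltxx ?andbF.
- exact: weak wu.
- rewrite (weak _ _ wom); congr (- _)%E; apply: eq_integral => t /set_mem/pbox_hbox ht.
  have [_ te _ _] := hboxP p rangeU boxU ht.
  by rewrite /F /fext tuple_rowE ht.2 -te.
- by rewrite lee_wpmul2l ?lee_fin// leeD.
Qed.

(** Three nested boxes: the cutoff lives in [a, b] and is at least e on [a', b'], where the gradient
    is thus controlled; [c, d] is the region where F must already be controlled. *)
Lemma local_poincare (a' b' c d : nat -> R) :
  (forall j, a j < a' j) -> (forall j, b' j < b j) ->
  (forall j, a' j <= c j) -> (forall j, c j < d j) -> (forall j, d j <= b' j) ->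
  exists2 C : R, 0 < C & forall f u du om, H10_approx f u du om ->
    (\int[lam]_(t in cbox n.+1 a' b') (fext f i (tuple_row t) ^+ 2)%:E <=
     C%:E * (\int[lam]_(t in cbox n.+1 c d) (fext f i (tuple_row t) ^+ 2)%:E +
             (form_L2norm2 g mu du + form_L2norm2 g mu om)))%E.
Proof.
move=> aa' b'b a'c cd db'.
have [C0 C00 HC0] := @cbox_poincare R n.+1 a' b' c d a'c cd db'.
have [chi [e [schi chi01 chiab e0 chie]]] := bump_box n.+1 aa' b'b.
have ab j : a j <= b j.
  by have := aa' j; have := b'b j; have := a'c j; have := cd j; have := db' j; lra.
have a'b' : rbox a' b' `<=` @rbox R n.+1 a b.
  by move=> y hy j; have := hy j; have := aa' j; have := b'b j; lra.
have s2s1 : 0 < s2 / s1 by rewrite divr_gt0.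
(* 1/e removes the cutoff, 2 comes from [weak_gradient_bound], and s2/s1 from comparing covector
   norms and measures with their Euclidean versions. *)
pose K := e^-1 * 2 * (s2 / s1).
have K0 : 0 < K by rewrite !mulr_gt0// invr_gt0.
exists (C0 * (1 + n.+1%:R * K)); first by rewrite mulr_gt0// addr_gt0// mulr_gt0.
move=> f u du om H; have [fM _ _ _] := H.
set N := (form_L2norm2 g mu du + _)%E.
have form0 (w : covector_field M) : (0 <= form_L2norm2 g mu w)%E.
  apply: integral_ge0 => q _; rewrite lee_fin /conorm2; apply: posdef_inv_ge0.
  by apply: gram_posdefP; exact: dom_chart_at.
have N0 : (0 <= N)%E by exact: adde_ge0.
have sF : smooth_open U (fext f i) by exact: (fext_smooth hT fM oU rangeU).
have F1 := smooth_open_C1 sF.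
have cU' (t : tup) : cbox n.+1 a' b' t -> U (tuple_row t) by move=> /rbox_row/a'b'/boxU.
have mcont (h : E -> R) : (forall x, U x -> {for x, continuous h}) ->
    measurable_fun (cbox n.+1 a' b') (fun t : tup => h (tuple_row t)).
  move=> ch; apply: measurable_funS (continuous_tuple_measurable oU ch) => //.
  exact: open_tuple_measurable.
have grad k : (\int[lam]_(t in cbox n.+1 a' b') (partial k (fext f i) (tuple_row t) ^+ 2)%:E <=
    K%:E * N)%E.
  have G := gradient_cutoff_bound k H ab schi chi01 chiab.
  have -> : (K%:E * N = (e^-1)%:E * (2%:E * ((s2 / s1)%:E * form_L2norm2 g mu du +
      (s2 / s1)%:E * form_L2norm2 g mu om)))%E.
    by rewrite /K /N -ge0_muleDr// !EFinM !muleA.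
  rewrite -lee_pdivrMl ?invr_gt0// invrK; apply: le_trans G.
  rewrite -ge0_integralZl//; last 4 first.
  - exact: measurable_cbox.
  - apply: measurable_sq; apply: mcont => x /F1[_ _ cp]; exact: cp.
  - by move=> t _; rewrite lee_fin sqr_ge0.
  - by rewrite lee_fin ltW.
  apply: ge0_le_integral_nomeas.
  - by move=> t /rbox_row/a'b'/rbox_row.
  - by move=> t _; rewrite -EFinM lee_fin mulr_ge0 ?sqr_ge0// ltW.
  - by move=> t _; rewrite lee_fin mulr_ge0 ?sqr_ge0//; have /andP[] := chi01 (tuple_row t).
  - by move=> t /rbox_row ct; rewrite -EFinM lee_fin mulrC ler_wpM2l ?sqr_ge0// chie.
apply: le_trans (HC0 (fun t => fext f i (tuple_row t))
  (fun k t => partial k (fext f i) (tuple_row t)) _ _ _) _.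
- by apply: mcont => x /F1[].
- by move=> k; apply: mcont => x /F1[_ _ cp]; exact: cp.
- exact: (C1_line_C1 F1).
rewrite EFinM -muleA lee_wpmul2l ?lee_fin ?(ltW C00)//.
set I := (\int[lam]_(t in cbox n.+1 c d) _)%E.
have I0 : (0 <= I)%E by exact: integral_sq_ge0.
have nK : 0 <= n.+1%:R * K by rewrite mulr_ge0 ?(ltW K0).
apply: (@le_trans _ _ (I + (n.+1%:R * K)%:E * N)%E).
  rewrite leeD2l//; apply: (le_trans (lee_sum _ (fun k _ => grad k))).
  rewrite -ge0_sume_distrl; last by move=> k _; rewrite lee_fin ltW.
  by rewrite sumEFin sumr_const card_ord (_ : K *+ n.+1 = n.+1%:R * K) ?mulr_natl.
rewrite EFinD ge0_muleDl ?lee_fin// mul1e leeD//; first by rewrite leeDl.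
by rewrite lee_wpmul2l ?lee_fin// leeDr.
Qed.

End local_estimate.

(** * From charts to the manifold *)

Section global_estimate.
Context (R : realType) (n : nat) (T : ptopologicalType) (M : smooth_atlas R n T).
Variable g : riemannian_metric M.
Variable mu : {measure set (borel T) -> \bar R}.
Hypothesis vol : is_riemannian_volume g mu.
Hypothesis hT : hausdorff_space T.
Local Notation E := 'rV[R]_n.+1.
Local Notation tup := (n.+1.-tuple (measurableTypeR R)).
Local Notation lam := (@lebesgue_tuple R n.+1).

Definition poincare_on (W : set (borel T)) := exists2 C : R, 0 < C &
  forall (f u : T -> R) (du om : covector_field M), H10_approx g mu f u du om ->
    (\int[mu]_(q in W) (f q ^+ 2)%:E <=
     C%:E * (form_L2norm2 g mu du + form_L2norm2 g mu om))%E.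

Lemma form_L2norm2_ge0 (w : covector_field M) : (0 <= form_L2norm2 g mu w)%E.
Proof.
apply: integral_ge0 => q _; rewrite lee_fin /conorm2; apply: posdef_inv_ge0.
by apply: gram_posdefP; exact: dom_chart_at.
Qed.

Lemma measurable_smooth f : smooth_compact_support M f ->
  measurable_fun [set: borel T] (f : borel T -> R).
Proof.
by move=> fM; apply: continuous_borel => [|q _]; [exact: openT|exact: smooth_continuous fM q].
Qed.

(** W is fixed before q and V: a good neighbourhood anywhere in W, however small, makes all of W
    good. This uniformity is what makes the set of good points closed. *)
Lemma chart_window p : exists W : set T,
  [/\ open W, W p, mboundary M p -> poincare_on W &
    forall q V, W q -> open V -> V q -> poincare_on V -> poincare_on W].
Proof.
pose i := chart_at M p; have ip : dom i p := dom_chart_at M p.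
have [U [r [s1 [s2 [[oU rU] r0 s10 s20 bnd]]]]] := chart_bounds g ip.
(* Box bounds are sequences on [nat]; [inord] supplies harmless values beyond the dimension, which
   keeps the required inequalities valid at every index. *)
pose xc (j : nat) : R := coords i p 0 (inord j).
(* The box of half-width r carries the cutoff; the estimate is obtained on the concentric one of
   half-width r/2. *)
pose a j := xc j - r; pose b j := xc j + r.
pose a' j := xc j - r / 2; pose b' j := xc j + r / 2.
have xcE (k : 'I_n.+1) : xc k = coords i p 0 k by rewrite /xc inord_val.
have nearx (y : E) : rbox a b y -> forall k, `|y 0 k - coords i p 0 k| <= r.
  by move=> hy k; have := hy k; rewrite /a /b xcE ler_norml; lra.
have boxU : rbox a b `<=` U by move=> y /nearx/bnd[].
have s12 (y : E) : rbox a b y -> 0 <= y 0 0 ->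
  s1 <= Num.sqrt (\det (gram g i (param i y))) <= s2 by move=> /nearx/bnd[_ H] /H[].
have gram_le (y : E) k : rbox a b y -> 0 <= y 0 0 -> gram g i (param i y) k k <= s2.
  by move=> /nearx/bnd[_ H] /H[_]; exact.
have sub (c d : nat -> R) : (forall j, a' j <= c j) -> (forall j, d j <= b' j) ->
    rbox c d `<=` @rbox R n.+1 a b.
  by move=> ac db y hy k; have := hy k; have := ac k; have := db k; rewrite /a /b /a' /b'; lra.
have a'b' : rbox a' b' `<=` @rbox R n.+1 a b by apply: sub.
pose W := [set q | dom i q /\ forall k, `|coords i q 0 k - coords i p 0 k| < r / 2].
have oball : open [set y : E | forall k, `|y 0 k - coords i p 0 k| < r / 2].
  rewrite (_ : [set y | _] = ball (coords i p) (r / 2)).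
    by apply: ball_open; rewrite divr_gt0.
  apply/seteqP; split=> y /= Hy.
    split; first by rewrite divr_gt0.
    by move=> l k; rewrite ord1 /ball/= distrC; exact: Hy.
  by move=> k; rewrite distrC; exact: (Hy.2 0 k).
have oW : open W by exact: open_coords_preimage oball.
have Wp : W p by split=> // k; rewrite subrr normr0 divr_gt0.
have Wbox : W `<=` mbox i a' b'.
  by move=> q [iq Wq]; split=> // k; have := Wq k; rewrite /a' /b' xcE ltr_norml; lra.
(* A bound on any sub-box [c, d] suffices: [local_poincare] extends it to the box around p, and the
   volume comparison brings it back to W. *)
have spread (c d : nat -> R) : (forall j, a' j <= c j) -> (forall j, c j < d j) ->
    (forall j, d j <= b' j) ->
    (exists2 C : R, 0 < C & forall f u du om, H10_approx g mu f u du om ->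
      (\int[lam]_(t in cbox n.+1 c d) (fext f i (tuple_row t) ^+ 2)%:E <=
       C%:E * (form_L2norm2 g mu du + form_L2norm2 g mu om))%E) ->
    poincare_on W.
  move=> ac cd db [C C0 HC].
  have [|j|C' C'0 HC'] := local_poincare vol hT p s10 s20 oU rU boxU s12 gram_le _ _ ac cd db.
  - by move=> j; rewrite /a /a'; lra.
  - by rewrite /b /b'; lra.
  exists (s2 * (C' * (C + 1))); first by rewrite !mulr_gt0// addr_gt0.
  move=> f u du om H; set N := (_ + _)%E.
  have N0 : (0 <= N)%E by apply: adde_ge0; exact: form_L2norm2_ge0.
  have [fM _ _ _] := H.
  have mf := measurable_smooth fM.
  apply: (@le_trans _ _ (\int[mu]_(q in (mbox i a' b' : set (borel T))) (f q ^+ 2)%:E)%E).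
    by apply: ge0_le_integral_nomeas => // q _; rewrite lee_fin sqr_ge0.
  have mfD : measurable_fun (mbox i a' b' : set (borel T)) (fun q => (f q ^+ 2)%:E).
    by apply: measurable_sq; exact: measurable_funTS mf.
  have [_ HD] := @chart_integral_bounds _ _ _ _ _ _ vol i p a' b' U s1 s2 s10 s20 rU
    (subset_trans a'b' boxU) (fun y yb => s12 y (a'b' y yb)) _ (fun q => (f q ^+ 2)%:E)
    (@measurable_mbox _ _ _ _ _ _ _) (@subset_refl _ _) mfD (fun q _ => sqr_ge0 (f q)).
  apply: (le_trans HD); rewrite EFinM -muleA lee_wpmul2l ?lee_fin ?(ltW s20)//.
  apply: (@le_trans _ _ (\int[lam]_(t in cbox n.+1 a' b') (fext f i (tuple_row t) ^+ 2)%:E)%E).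
    apply: ge0_le_integral_nomeas.
    - by move=> t [_ []].
    - by move=> t _; rewrite lee_fin sqr_ge0.
    - by move=> t _; rewrite lee_fin sqr_ge0.
    - move=> t [_ ht]; have [_ te _ _] := hboxP p rU (subset_trans a'b' boxU) ht.
      by rewrite te /fext tuple_rowE ht.2.
  apply: (le_trans (HC' f u du om H)); rewrite EFinM -muleA lee_wpmul2l ?lee_fin ?(ltW C'0)//.
  by rewrite EFinD ge0_muleDl ?lee_fin ?(ltW C0)// mul1e leeD2r// (HC f u du om H).
exists W; split => //.
(* In the first coordinate this sub-box is [-r/2, 0], where [fext] vanishes, so any constant will
   do. *)
- move=> bp; apply: (spread a' xc).
  + by [].
  + by move=> j; rewrite /a'; lra.
  + by move=> j; rewrite /b'; lra.
  exists 1 => // f u du om H; have [fM _ _ _] := H.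
  rewrite (_ : (\int[lam]_(t in _) _)%E = 0%E).
    by rewrite mul1e adde_ge0// form_L2norm2_ge0.
  have x0 : coords i p 0 0 = 0.
    have := coords_ge0 ip; rewrite le_eqVlt => /predU1P[//|x0].
    by have /(_ bp) := (minterior_coord g ip).2 x0.
  apply: integral0_eq => t ct; rewrite (fext_eq0 hT fM rU) ?expr0n//.
    apply: boxU; apply: (sub a' xc) => //; last exact/rbox_row.
    by move=> j; rewrite /b'; lra.
  rewrite tuple_rowE; have /andP[_] := ct ord0.
  by rewrite (_ : xc 0%N = 0)// -x0 -(xcE ord0).
- move=> q V [iq Wq] oV Vq [C C0 HC].
  have nq := coords_open_image oV Vq iq.
  have /nbhs_rVP[e1 e10 H1] := nq.
  have /nbhs_rVP[e2 e20 H2] : nbhs (coords i q) [set y : E | forall k, `|y 0 k - coords i p 0 k| < r / 2].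
    exact: open_nbhs_nbhs.
  (* Within e1 of the coordinates of q, points of the half-space land in V; within e2 they stay in
     the window. Halving makes closed boxes fit. *)
  pose m := Num.min e1 e2; pose e := m / 2.
  have m0 : 0 < m by rewrite lt_min e10 e20.
  have me1 : m <= e1 by rewrite ge_min lexx.
  have me2 : m <= e2 by rewrite ge_min lexx orbT.
  have e0 : 0 < e by rewrite divr_gt0.
  have ee1 : e < e1 by rewrite /e; lra.
  have ee2 : e < e2 by rewrite /e; lra.
  (* The sub-box has q as its lowest corner: growing only upwards, it stays in the half-space even
     when q is on the boundary. *)
  pose c (j : nat) : R := coords i q 0 (inord j); pose d j := c j + e.
  have cE (k : 'I_n.+1) : c k = coords i q 0 k by rewrite /c inord_val.
  have ac j : a' j <= c j.
    by have := Wq (inord j); rewrite /a' /c /xc ltr_norml => /andP[]; lra.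
  have db j : d j <= b' j.
    have := H2 (coords i q + const_mx e).
    have near2 (k : 'I_n.+1) : `|(coords i q + const_mx e) 0 k - coords i q 0 k| < e2.
      by rewrite !mxE addrAC subrr add0r gtr0_norm.
    move=> /(_ near2 (inord j)); rewrite !mxE ltr_norml => /andP[_].
    by rewrite /d /b' /c /xc; lra.
  have cd j : c j < d j by rewrite /d ltrDl.
  have cdab : rbox c d `<=` @rbox R n.+1 a b by exact: sub.
  have cdV : mbox i c d `<=` V.
    move=> q' [iq' bq'].
    have near1 (k : 'I_n.+1) : `|coords i q' 0 k - coords i q 0 k| < e1.
      have := bq' k; rewrite /d cE => /andP[h1 h2].
      by rewrite ger0_norm ?subr_ge0//; lra.
    have [q'' [Vq'' _ _ pq]] := H1 _ near1 (coords_ge0 iq').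
    by move: pq; rewrite coordK// => ->.
  apply: (spread c d) => //; exists (s1^-1 * C); first by rewrite mulr_gt0// invr_gt0.
  move=> f u du om H; set N := (_ + _)%E; have [fM _ _ _] := H.
  have mfD : measurable_fun (mbox i c d : set (borel T)) (fun q => (f q ^+ 2)%:E).
    by apply: measurable_sq; exact: measurable_funTS (measurable_smooth fM).
  have [HD _] := @chart_integral_bounds _ _ _ _ _ _ vol i p c d U s1 s2 s10 s20 rU
    (subset_trans cdab boxU) (fun y yb => s12 y (cdab y yb)) _ (fun q => (f q ^+ 2)%:E)
    (@measurable_mbox _ _ _ _ _ _ _) (@subset_refl _ _) mfD (fun q _ => sqr_ge0 (f q)).
  rewrite EFinM -muleA -lee_pdivrMl ?invr_gt0// invrK.
  apply: le_trans (HC f u du om H); rewrite -/N.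
  apply: (@le_trans _ _ (\int[mu]_(q in (mbox i c d : set (borel T))) (f q ^+ 2)%:E)%E); last first.
    by apply: ge0_le_integral_nomeas => // q' _; rewrite lee_fin sqr_ge0.
  apply: le_trans HD; rewrite lee_wpmul2l ?lee_fin ?(ltW s10)//.
  have cdh t : cbox n.+1 c d t -> hbox c d t.
    move=> ct; split=> //; have /andP[h _] := ct ord0; apply: le_trans h.
    by rewrite (cE ord0); exact: coords_ge0.
  apply: ge0_le_integral_nomeas.
  - move=> t /cdh ht; split=> //.
    by have [_ _ mt _] := hboxP p rU (subset_trans cdab boxU) ht.
  - by move=> t _; rewrite lee_fin sqr_ge0.
  - by move=> t _; rewrite lee_fin sqr_ge0.
  - move=> t /cdh ht; have [_ te _ _] := hboxP p rU (subset_trans cdab boxU) ht.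
    by rewrite te /fext tuple_rowE ht.2.
Qed.

End global_estimate.

(** * Propagation by connectedness and compactness *)

Section globalization.
Context (R : realType) (n : nat) (T : ptopologicalType) (M : smooth_atlas R n T).
Variable g : riemannian_metric M.
Variable mu : {measure set (borel T) -> \bar R}.
Hypothesis vol : is_riemannian_volume g mu.
Hypothesis hT : hausdorff_space T.

Lemma poincare_onU (A B : set (borel T)) : measurable A -> measurable B ->
  poincare_on g mu A -> poincare_on g mu B -> poincare_on g mu (A `|` B).
Proof.
move=> mA mB [CA CA0 HA] [CB CB0 HB]; exists (CA + CB); first exact: addr_gt0.
move=> f u du om H; have [fM _ _ _] := H.
have mBA : measurable (B `\` A) by exact: measurableD.
have mf2 : measurable_fun [set: borel T] (fun q => (f q ^+ 2)%:E).
  by apply: measurable_sq; exact: measurable_smooth fM.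
have -> : A `|` B = A `|` (B `\` A) by rewrite setUDr setDv setD0.
rewrite ge0_integral_setU//; last 3 first.
- exact: measurable_funTS.
- by move=> q _; rewrite lee_fin sqr_ge0.
- by apply/disj_setPS => q [Aq [_ nAq]]; exact: nAq.
rewrite EFinD ge0_muleDl ?lee_fin ?(ltW CA0) ?(ltW CB0)// leeD//; first exact: (HA f u du om H).
apply: le_trans (HB f u du om H).
by apply: ge0_le_integral_nomeas => [q []|q _|q _|] //; rewrite lee_fin sqr_ge0.
Qed.

Lemma poincare_on_bigU (I : Type) (s : seq I) (W : I -> set (borel T)) :
  (forall x, measurable (W x)) -> (forall x, poincare_on g mu (W x)) ->
  poincare_on g mu (\big[setU/set0]_(x <- s) W x).
Proof.
move=> mW pW; elim: s => [|x s IH].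
  rewrite big_nil; exists 1 => // f u du om _.
  by rewrite integral_set0 mul1e adde_ge0// form_L2norm2_ge0.
by rewrite big_cons; apply: poincare_onU => //; exact: bigsetU_measurable.
Qed.

Hypothesis cT : compact [set: T].
Hypothesis coT : connected [set: T].
Hypothesis bT : mboundary M !=set0.

Lemma poincare_locally p : exists W : set T, [/\ open W, W p & poincare_on g mu W].
Proof.
pose G := [set q | exists W : set T, [/\ open W, W q & poincare_on g mu W]].
suff GT : G = [set: T] by have : G p by rewrite GT.
have oG : open G.
  rewrite openE => q [W [oW Wq pW]]; apply: filterS (open_nbhs_nbhs (conj oW Wq)).
  by move=> z Wz; exists W.
apply: coT.
- have [q bq] := bT; exists q; have [W [oW Wq + _]] := chart_window vol hT q.
  by move=> /(_ bq) pW; exists W.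
- by exists G => //; rewrite setTI.
(* The window of a limit point q contains some z in G, and the good neighbourhood of z is passed on
   to the whole window. *)
- exists (closure G); first exact: closed_closure.
  rewrite setTI; apply/seteqP; split; first exact: subset_closure.
  move=> q; have [W [oW Wq _ HW]] := chart_window vol hT q.
  move=> /(_ W (open_nbhs_nbhs (conj oW Wq)))[z [[V [oV Vz pV]] Wz]].
  by exists W; split => //; exact: HW Wz oV Vz pV.
Qed.

Lemma poincare_global : poincare_on g mu setT.
Proof.
have /choice[W HW] := poincare_locally.
have mW x : measurable (W x : set (borel T)).
  by apply: open_borel; have [] := HW x.
have pW x : poincare_on g mu (W x) by have [] := HW x.
move: cT; rewrite compact_cover => /(_ T setT W) []; first by move=> x _; have [] := HW x.
  by move=> x _; exists x => //; have [] := HW x.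
move=> D _ TD; have [C C0 HC] := poincare_on_bigU (finmap.enum_fset D) mW pW.
exists C => // f u du om H; apply: le_trans (HC f u du om H).
apply: ge0_le_integral_nomeas => // [q _|q _|q _]; rewrite ?lee_fin ?sqr_ge0//.
by have := TD q I; rewrite /cover bigcup_seq.
Qed.

End globalization.

Theorem theorem1 (R : realType) (n : nat) (T : ptopologicalType)
    (M : smooth_atlas R n T) (g : riemannian_metric M)
    (mu : {measure set (borel T) -> \bar R}) :
  compact [set: T] -> hausdorff_space T -> connected [set: T] ->
  mboundary M !=set0 ->
  is_riemannian_volume g mu ->
  exists2 C : R, 0 < C &
    forall (u : T -> R) (du : covector_field M),
      H10 g mu u -> is_differential g mu u du ->
      (L2norm2 M mu u <= C%:E * form_L2norm2 g mu du)%E.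
Proof.
move=> cT hT coT bT vol.
have [C C0 HC] := poincare_global vol hT cT coT bT.
exists (2 * C); first by rewrite mulr_gt0.
move=> u du [[uL2 _] Hu] Hdu; apply/lee_addgt0Pr => e e0.
(* The two error terms add up to 2 d + 2 C d = e. *)
pose d := e / (2 + 2 * C).
have C20 : 0 < 2 + 2 * C by rewrite addr_gt0// mulr_gt0.
have d0 : 0 < d by rewrite divr_gt0.
have [f [om [fM Hom small]]] := Hu d d0.
have mI : measurable (minterior M : set (borel T)).
  by apply: open_borel; exact: open_minterior g.
have mf : measurable_fun (minterior M : set (borel T)) (f : borel T -> R).
  by apply: measurable_funTS; exact: measurable_smooth fM.
have muf : measurable_fun (minterior M : set (borel T)) (fun q : borel T => u q - f q).
  by apply: measurable_funB => //; exact: uL2.1.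
have Hf : (\int[mu]_(q in (minterior M : set (borel T))) (f q ^+ 2)%:E <=
    C%:E * (form_L2norm2 g mu du + form_L2norm2 g mu om))%E.
  apply: le_trans (HC f u du om _) => //.
  by apply: ge0_le_integral_nomeas => // q _; rewrite lee_fin sqr_ge0.
have omge := form_L2norm2_ge0 g mu om.
have duge := form_L2norm2_ge0 g mu du.
have ufge : (0 <= L2norm2 M mu (u \- f)%R)%E by exact: integral_sq_ge0.
have Hom' : (form_L2norm2 g mu om <= d%:E)%E.
  by apply: le_trans (ltW small); rewrite leeDr.
have Huf : (L2norm2 M mu (u \- f)%R <= d%:E)%E.
  by apply: le_trans (ltW small); rewrite leeDl.
have dufin := Hdu.1.2.
apply: (@le_trans _ _ (2%:E * L2norm2 M mu (u \- f)%R +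
    2%:E * \int[mu]_(q in (minterior M : set (borel T))) (f q ^+ 2)%:E)%E).
  rewrite /L2norm2 -ge0_integralZl//; last 2 first.
  - exact: (measurable_sq muf).
  - by move=> q _; rewrite lee_fin sqr_ge0.
  rewrite -ge0_integralZl//; last 2 first.
  - exact: (measurable_sq mf).
  - by move=> q _; rewrite lee_fin sqr_ge0.
  rewrite -ge0_integralD//; last 4 first.
  - by move=> q _; rewrite -EFinM lee_fin mulr_ge0// sqr_ge0.
  - by apply: emeasurable_funM => //; exact: (measurable_sq muf).
  - by move=> q _; rewrite -EFinM lee_fin mulr_ge0// sqr_ge0.
  - by apply: emeasurable_funM => //; exact: (measurable_sq mf).
  apply: ge0_le_integral_nomeas => // q _; rewrite -?EFinM -?EFinD lee_fin.
  - exact: sqr_ge0.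
  - by rewrite addr_ge0// mulr_ge0// sqr_ge0.
  (* This square is the defect in u^2 <= 2 (u - f)^2 + 2 f^2. *)
  - by have := sqr_ge0 (u q - 2 * f q) => /=; nra.
apply: (@le_trans _ _ (2%:E * d%:E + 2%:E * (C%:E * (form_L2norm2 g mu du + d%:E)))%E).
  apply: leeD; first by rewrite lee_wpmul2l.
  rewrite lee_wpmul2l//; apply: le_trans Hf _.
  by rewrite lee_wpmul2l ?lee_fin ?(ltW C0)// leeD2l.
move: duge dufin; case: (form_L2norm2 g mu du) => // x _ _.
rewrite -!(EFinD, EFinM) lee_fin.
have -> : e = d * (2 + 2 * C) by rewrite /d divfK// gt_eqF.
by rewrite le_eqVlt; apply/orP; left; apply/eqP; ring.
Qed.
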